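(* Let $D_1, D_2 \subset \mathbb{C}$ be smoothly bounded domains with $D_1 \cap D_2 \neq \emptyset$. Then there exists a constant $C = C(D_1, D_2) > 0$, depending only on $D_1$ and $D_2$, such that $$c_{D_1 \cap D_2}(z) \cdot c_{D_1 \cup D_2}(z) \leq C\, c_{D_1}(z) \cdot c_{D_2}(z)$$ for all $z \in D_1 \cap D_2$. Here $c_D$ denotes the (density of the) Carathéodory metric of $D$, and $c_{D_1 \cap D_2}(z)$ denotes the Carathéodory metric, at $z$, of the connected component of $D_1 \cap D_2$ that contains $z$; the constant $C$ does not depend on the component.
   Context: A domain is a nonempty connected open subset of $\mathbb{C}$, and $\mathbb{D} = \{w \in \mathbb{C} : |w| < 1\}$ is the unit disc. A smoothly bounded domain is a bounded domain in $\mathbb{C}$ whose boundary is $C^\infty$-smooth (so the boundary consists of finitely many disjoint $C^\infty$-smooth Jordan curves). For a domain $D \subset \mathbb{C}$ that admits at least one non-constant bounded holomorphic function, the Carathéodory metric $c_D(z)\,|dz|$ is defined, for $z \in D$, by $$c_D(z) = \sup\{\, |f'(z)| : f : D \to \mathbb{D} \text{ holomorphic and } f(z) = 0 \,\}.$$ The set $D_1 \cap D_2$ may have several connected components. For $z \in D_1 \cap D_2$, the notation $c_{D_1 \cap D_2}(z)$ means $c_U(z)$, where $U$ is the connected component of $D_1 \cap D_2$ containing $z$. *)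

(* Defs.v *)
From HB Require Import structures.
From mathcomp Require Import all_boot all_order all_algebra.
From mathcomp Require Import all_classical all_reals all_analysis.
From mathcomp Require Import complex.

Set Implicit Arguments.
Unset Strict Implicit.
Unset Printing Implicit Defensive.

Import Order.TTheory GRing.Theory Num.Theory.
Import numFieldNormedType.Exports.

Local Open Scope classical_set_scope.
Local Open Scope ring_scope.

(* The complex plane over R. The regular algebra [^o] carries the topology and
   the normed module structure (over R[i] itself) given by the modulus, so that
   [derivable] and [derive1] are complex differentiability and the complex
   derivative. *)
Notation Cplane R := ((R[i])^o).

(* The norm of R[i] takes its values in R[i]; this is the same number in R. *)
Definition modulus (R : realType) (z : Cplane R) : R := complex.Re `|z|.

Definition is_domain (R : realType) (D : set (Cplane R)) : Prop :=
  [/\ D !=set0, open D & connected D].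

Definition unit_disc (R : realType) : set (Cplane R) :=
  [set w | modulus w < 1].

(* Only used with D open, where it depends only on the restriction of f to D. *)
Definition holomorphic_on (R : realType) (D : set (Cplane R))
    (f : Cplane R -> Cplane R) : Prop :=
  forall w, D w -> derivable f w 1.

(* Functions D -> unit_disc are represented by total functions whose values
   outside D are irrelevant. The supremum is taken in \bar R so that it is
   meaningful without a prior proof that the set is bounded. *)
Definition caratheodory (R : realType) (D : set (Cplane R)) (z : Cplane R)
    : \bar R :=
  ereal_sup [set (modulus (derive1 f z))%:E | f in
    [set f : Cplane R -> Cplane R |
      [/\ holomorphic_on D f, f @` D `<=` @unit_disc R & f z = 0]]].

(* C^oo on an open set U: all iterated directional derivatives (in particular
   all iterated partial derivatives) are differentiable, hence continuous,
   on U. *)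
Definition smooth_on (R : realType) (U : set (R * R)) (rho : R * R -> R)
    : Prop :=
  forall (vs : seq (R * R)) (x : R * R), U x ->
    differentiable (foldr (fun v g => 'D_v g) rho vs) x.

Definition to_R2 (R : realType) (z : Cplane R) : R * R :=
  (complex.Re z, complex.Im z).

Definition boundary (R : realType) (D : set (Cplane R)) : set (Cplane R) :=
  closure D `\` interior D.

(* C^oo boundary in the usual sense of a local defining function: near each
   boundary point, D is a sublevel set {rho < 0} of a C^oo real function without
   critical points. By compactness, the boundary of a bounded such domain is a
   finite disjoint union of C^oo Jordan curves. *)
Definition smooth_boundary (R : realType) (D : set (Cplane R)) : Prop :=
  forall p, boundary D p ->
    exists (U : set (Cplane R)) (rho : R * R -> R),
      [/\ open U, U p, smooth_on (@to_R2 R @` U) rho,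
          (forall z, U z -> exists v : R * R, 'd rho (to_R2 z) v != 0) &
          D `&` U = [set z | rho (to_R2 z) < 0] `&` U].

Definition smoothly_bounded_domain (R : realType) (D : set (Cplane R)) : Prop :=
  [/\ is_domain D, bounded_set D & smooth_boundary D].

(* Main.v *)
Require Import Defs.
From mathcomp Require Import all_boot all_order all_algebra.
From mathcomp Require Import all_classical all_reals all_analysis.
From mathcomp Require Import complex.
From mathcomp Require Import ring lra.
Import Order.TTheory GRing.Theory Num.Theory.
Import numFieldNormedType.Exports.
Local Open Scope classical_set_scope.
Local Open Scope ring_scope.
Set Implicit Arguments.
Unset Strict Implicit.
Unset Printing Implicit Defensive.

(** Everything is compared with the discs centred at [z] that the domains
    contain. The density of a domain containing the disc of radius [d] about [z]
    is at most a constant over [d] ([caratheodory_le]); this is Cauchy's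
    estimate. Conversely, for a smoothly bounded domain [D] there is [c > 0] such
    that the disc of radius [c / c_D(z)] about [z] lies in [D]
    ([caratheodory_disc]). Let [r1] and [r2] be these radii for [D1] and [D2].
    The disc of radius [min r1 r2] lies in [D1 `&` D2], hence in the component
    of [z], and the disc of radius [max r1 r2] lies in the union. So the
    left-hand side is at most a constant over [min r1 r2 * max r1 r2 = r1 * r2],
    that is, at most a constant times [c_D1(z) * c_D2(z)].

    The converse bound is where smoothness is used. A local defining function
    has a nonzero gradient and bounded second derivatives, so that near a
    boundary point every point [p] outside [D] lies on a disc of fixed radius
    [r] that misses [D] ([exterior_disc]). If [q] is its centre, [r / (w - q)]
    maps [D] into the unit disc, and its derivative at [z], normalised by a
    Blaschke factor, is at least a constant over [|z - p|]
    ([caratheodory_exterior_disc]). Compactness makes the constant uniform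
    ([distance_bound_uniform]).

    Cauchy's estimate has to be proved for functions that are only
    differentiable at each point, so it rests on Goursat's theorem. The theorem
    is used for a closed real form [P dx + Q dy], whose integral around a
    rectangle is expressed by primitives of [P] and [Q] along horizontal and
    vertical lines; subdivision is then an algebraic identity and all estimates
    are mean value theorems ([goursat]). Applied to
    [Im (conj (g' 0) * g w / w ^ 2 dw)] between two squares centred at the zero
    of [g], it bounds [|g' 0|] ([square_annulus], [cauchy_estimate0]). *)

(** * Goursat's theorem for pointwise differentiable real one-forms *)

Lemma mvt_is_derive (R : realType) (H h : R -> R) (a b : R) :
  a <= b -> (forall t, a <= t <= b -> is_derive t 1 H (h t)) ->
  exists t, a <= t <= b /\ H b - H a = h t * (b - a).
Proof.
rewrite le_eqVlt => /predU1P[-> _|ab dH].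
  by exists b; rewrite lexx !subrr mulr0.
have [t tab ->] : exists2 t, t \in `]a, b[%R & H b - H a = h t * (b - a).
  apply: MVT => //.
    by move=> t /andP[at1 tb]; apply: dH; apply/andP; split; exact: ltW.
  apply: continuous_in_subspaceT => t; rewrite inE/= in_itv/= => tab.
  apply/differentiable_continuous/derivable1_diffP.
  exact: (@ex_derive _ _ _ _ _ _ _ (dH t tab)).
exists t; split=> //; move: tab; rewrite in_itv/= => /andP[at1 tb].
by apply/andP; split; exact: ltW.
Qed.

(** If [A] is a primitive of [P] along horizontal lines and [B] one of [Q]
    along vertical lines, the mixed difference of [A - B] is the integral of
    [P dx + Q dy] around the rectangle [[a, b] x [c, d]], counterclockwise. *)
Definition mixed_diff (R : realType) (E : R -> R -> R) (a b c d : R) : R :=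
  E b c - E a c - E b d + E a d.

(** The form [P dx + Q dy] is differentiable and closed at the point: the same
    number [p] is the partial derivative of [P] in [y] and of [Q] in [x]. *)
Definition closed_form_at (R : realType) (P Q : R -> R -> R) (x0 y0 : R) :=
  exists p q p' : R, forall eta : R, 0 < eta -> exists2 delta : R, 0 < delta &
    forall x y : R, `|x - x0| < delta -> `|y - y0| < delta ->
      `|P x y - P x0 y0 - q * (x - x0) - p * (y - y0)|
        <= eta * (`|x - x0| + `|y - y0|) /\
      `|Q x y - Q x0 y0 - p * (x - x0) - p' * (y - y0)|
        <= eta * (`|x - x0| + `|y - y0|).

(** By the mean value theorem each pair of opposite sides contributes the
    number [p] of [closed_form_at] times the area, up to the remainder of the
    expansion; the two signs are opposite, so only remainders survive. *)
Lemma mixed_diff_local (R : realType) (P Q A B : R -> R -> R) (x0 y0 eta : R) :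
  closed_form_at P Q x0 y0 -> 0 < eta ->
  exists2 delta : R, 0 < delta & forall a b c d : R,
    (forall x y : R, a <= x <= b -> c <= y <= d ->
      is_derive x 1 (A ^~ y) (P x y) /\ is_derive y 1 (B x) (Q x y)) ->
    a <= x0 <= b -> c <= y0 <= d -> b - a < delta -> d - c < delta ->
    `|mixed_diff (fun x y => A x y - B x y) a b c d|
      <= eta * ((b - a) + (d - c)) ^+ 2.
Proof.
move=> [p [q [p' H]]] eta0.
have [|delta d0 {}H] := H (eta / 2); first lra.
exists delta => // a b c d dAB /andP[ax xb] /andP[cy yd] ba dc.
have ab : a <= b by lra.
have cd : c <= d by lra.
have [t [tab tE]] : exists t, a <= t <= b /\
    (A b c - A b d) - (A a c - A a d) = (P t c - P t d) * (b - a).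
  apply: (@mvt_is_derive _ (fun t => A t c - A t d) (fun t => P t c - P t d)) => // t tab.
  by apply: is_deriveB; apply dAB; rewrite // lexx cd.
have [s [scd sE]] : exists s, c <= s <= d /\
    (B b d - B a d) - (B b c - B a c) = (Q b s - Q a s) * (d - c).
  apply: (@mvt_is_derive _ (fun t => B b t - B a t) (fun t => Q b t - Q a t)) => // s scd.
  by apply: is_deriveB; apply dAB; rewrite // lexx ab.
have -> : mixed_diff (fun x y => A x y - B x y) a b c d =
  (P t c - P t d) * (b - a) + (Q b s - Q a s) * (d - c).
  by rewrite -tE -sE /mixed_diff; ring.
have /andP[at1 tb] := tab; have /andP[cs sd] := scd.
have aux (x y x1 x2 z : R) : x1 <= x <= x2 -> x1 <= y <= x2 -> x2 - x1 < z -> `|x - y| < z.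
  move=> /andP[? ?] /andP[? ?] ?; rewrite ltr_norml; apply/andP; split; lra.
have aux' (x y x1 x2 : R) : x1 <= x <= x2 -> x1 <= y <= x2 -> `|x - y| <= x2 - x1.
  move=> /andP[? ?] /andP[? ?]; rewrite ler_norml; apply/andP; split; lra.
have X0 : a <= x0 <= b by rewrite ax xb.
have Y0 : c <= y0 <= d by rewrite cy yd.
have bnd x y : a <= x <= b -> c <= y <= d ->
      `|P x y - P x0 y0 - q * (x - x0) - p * (y - y0)|
        <= eta / 2 * ((b - a) + (d - c)) /\
      `|Q x y - Q x0 y0 - p * (x - x0) - p' * (y - y0)|
        <= eta / 2 * ((b - a) + (d - c)).
  move=> Hx Hy.
  have [h1 h2] := H x y (aux _ _ _ _ _ Hx X0 ba) (aux _ _ _ _ _ Hy Y0 dc).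
  have hh : eta / 2 * (`|x - x0| + `|y - y0|) <= eta / 2 * (b - a + (d - c)).
    by rewrite ler_pM2l; [rewrite lerD// aux'|lra].
  by split; [exact: (le_trans h1)|exact: (le_trans h2)].
have La : a <= a <= b by rewrite lexx ab.
have Lb : a <= b <= b by rewrite lexx ab.
have Lc : c <= c <= d by rewrite lexx cd.
have Ld : c <= d <= d by rewrite lexx cd.
have [Ptc _] := bnd t c tab Lc; have [Ptd _] := bnd t d tab Ld.
have [_ Qbs] := bnd b s Lb scd; have [_ Qas] := bnd a s La scd.
set L := b - a + (d - c) in Ptc Ptd Qbs Qas *.
have L0 : 0 <= L by rewrite /L; lra.
have PP : `|P t c - P t d + p * (d - c)| <= eta * L.
  move: Ptc Ptd; rewrite !ler_norml => /andP[? ?] /andP[? ?].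
  by apply/andP; split; lra.
have QQ : `|Q b s - Q a s - p * (b - a)| <= eta * L.
  move: Qbs Qas; rewrite !ler_norml => /andP[? ?] /andP[? ?].
  by apply/andP; split; lra.
have -> : (P t c - P t d) * (b - a) + (Q b s - Q a s) * (d - c) =
  (P t c - P t d + p * (d - c)) * (b - a) + (Q b s - Q a s - p * (b - a)) * (d - c).
  by ring.
have -> : eta * L ^+ 2 = eta * L * (b - a) + eta * L * (d - c) by rewrite /L; ring.
apply: (le_trans (ler_normD _ _)); rewrite !normrM.
rewrite (ger0_norm (_ : 0 <= b - a)) ?subr_ge0// (ger0_norm (_ : 0 <= d - c)) ?subr_ge0//.
by apply: lerD; apply: ler_wpM2r; rewrite // subr_ge0.
Qed.

(** A quarter of the rectangle that carries at least a quarter of the mixed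
    difference; when the first three fail, the last one must succeed. *)
Definition bisect (R : realType) (E : R -> R -> R) (r : R * R * (R * R)) :=
  let: (a, b, (c, d)) := r in
  let m := (a + b) / 2 in let n := (c + d) / 2 in
  let k := `|mixed_diff E a b c d| / 4 in
  if k <= `|mixed_diff E a m c n| then (a, m, (c, n)) else
  if k <= `|mixed_diff E m b c n| then (m, b, (c, n)) else
  if k <= `|mixed_diff E a m n d| then (a, m, (n, d)) else (m, b, (n, d)).

Lemma bisectP (R : realType) (E : R -> R -> R) (a b c d : R) :
  a <= b -> c <= d ->
  let: (a', b', (c', d')) := bisect E (a, b, (c, d)) in
  [/\ a <= a' /\ b' <= b, c <= c' /\ d' <= d, b' - a' = (b - a) / 2,
      d' - c' = (d - c) / 2 &
      `|mixed_diff E a b c d| / 4 <= `|mixed_diff E a' b' c' d'| ].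
Proof.
move=> ab cd; rewrite /bisect.
case: ifP => [h|/negbT]; first by split => //; try split; lra.
rewrite -ltNge => h1.
case: ifP => [h|/negbT]; first by split => //; try split; lra.
rewrite -ltNge => h2.
case: ifP => [h|/negbT]; first by split => //; try split; lra.
rewrite -ltNge => h3.
split; try by split; lra.
- lra.
- lra.
set m := (a + b) / 2 in h1 h2 h3 *; set n := (c + d) / 2 in h1 h2 h3 *.
have E4 : mixed_diff E a b c d = mixed_diff E a m c n + mixed_diff E m b c n +
  mixed_diff E a m n d + mixed_diff E m b n d by rewrite /mixed_diff; ring.
have := ler_normD (mixed_diff E a m c n + mixed_diff E m b c n + mixed_diff E a m n d)
  (mixed_diff E m b n d).
have := ler_normD (mixed_diff E a m c n + mixed_diff E m b c n) (mixed_diff E a m n d).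
have := ler_normD (mixed_diff E a m c n) (mixed_diff E m b c n).
rewrite -E4; lra.
Qed.

Lemma nested_point (R : realType) (a b : nat -> R) :
  (forall n, a n <= a n.+1) -> (forall n, b n.+1 <= b n) ->
  (forall n, a n <= b n) -> exists x, forall n, a n <= x <= b n.
Proof.
move=> a1 b1 ab.
have aM : {homo a : m n / (m <= n)%N >-> m <= n}.
  by apply: homo_leq => //; exact: le_trans.
have bM m n : (m <= n)%N -> b n <= b m.
  elim: n => [|n IH]; first by rewrite leqn0 => /eqP ->.
  rewrite leq_eqVlt => /predU1P[-> //|]; rewrite ltnS => /IH.
  exact: le_trans.
have ubn n : ubound (range a) (b n).
  move=> _ [k _ <-]; case: (leqP k n) => kn.
    exact: (le_trans (aM _ _ kn)).
  exact: (le_trans (ab k) (bM _ _ (ltnW kn))).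
exists (sup (range a)) => n; apply/andP; split.
  apply: ub_le_sup; first by exists (b 0).
  by exists n.
by apply: ge_sup => //; exists (a 0), 0.
Qed.

(** If the mixed difference were nonzero, repeated bisection would yield
    rectangles shrinking to a point on which it decreases only like the square
    of the side, contradicting [mixed_diff_local] at that point. *)
Lemma goursat (R : realType) (P Q A B : R -> R -> R) (a b c d : R) :
  a <= b -> c <= d ->
  (forall x y : R, a <= x <= b -> c <= y <= d ->
    [/\ closed_form_at P Q x y,
      is_derive x 1 (A ^~ y) (P x y) & is_derive y 1 (B x) (Q x y)]) ->
  mixed_diff (fun x y => A x y - B x y) a b c d = 0.
Proof.
move=> ab cd H; set E := fun x y => _.
apply/eqP/negPn; rewrite -normr_gt0; apply/negP => k0.
pose r n := iter n (bisect E) (a, b, (c, d)).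
pose a_ n := (r n).1.1; pose b_ n := (r n).1.2.
pose c_ n := (r n).2.1; pose d_ n := (r n).2.2.
have rE n : r n = (a_ n, b_ n, (c_ n, d_ n)).
  by rewrite /a_ /b_ /c_ /d_; case: (r n) => [[? ?] [? ?]].
have step n : a_ n <= b_ n -> c_ n <= d_ n ->
    [/\ a_ n <= a_ n.+1 /\ b_ n.+1 <= b_ n, c_ n <= c_ n.+1 /\ d_ n.+1 <= d_ n,
        b_ n.+1 - a_ n.+1 = (b_ n - a_ n) / 2,
        d_ n.+1 - c_ n.+1 = (d_ n - c_ n) / 2 &
      `|mixed_diff E (a_ n) (b_ n) (c_ n) (d_ n)| / 4 <=
      `|mixed_diff E (a_ n.+1) (b_ n.+1) (c_ n.+1) (d_ n.+1)| ].
  move=> h1 h2; have := bisectP E h1 h2.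
  by rewrite -rE -[bisect E (r n)]/(r n.+1) rE.
have ord n : [/\ a_ n <= b_ n, c_ n <= d_ n, a <= a_ n /\ b_ n <= b & c <= c_ n /\ d_ n <= d].
  elim: n => [|n [h1 h2 [h3 h4] [h5 h6]]]; first by split.
  by have [[? ?] [? ?] ? ? _] := step n h1 h2; split; try split; lra.
have ordab n : a_ n <= b_ n by case: (ord n).
have ordcd n : c_ n <= d_ n by case: (ord n).
have [x0 x0P] : exists x, forall n, a_ n <= x <= b_ n.
  apply: nested_point => // n; by have [[]] := step n (ordab n) (ordcd n).
have [y0 y0P] : exists x, forall n, c_ n <= x <= d_ n.
  apply: nested_point => // n; by have [_ []] := step n (ordab n) (ordcd n).
have szb n : b_ n - a_ n = (b - a) / 2 ^+ n.
  elim: n => [|n IH]; first by rewrite expr0 divr1.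
  by have [_ _ -> _ _] := step n (ordab n) (ordcd n); rewrite IH exprS invfM; ring.
have szd n : d_ n - c_ n = (d - c) / 2 ^+ n.
  elim: n => [|n IH]; first by rewrite expr0 divr1.
  by have [_ _ _ -> _] := step n (ordab n) (ordcd n); rewrite IH exprS invfM; ring.
set k := `|mixed_diff E a b c d| in k0.
have kn n : k / 4 ^+ n <= `|mixed_diff E (a_ n) (b_ n) (c_ n) (d_ n)|.
  elim: n => [|n IH]; first by rewrite expr0 divr1.
  have [_ _ _ _] := step n (ordab n) (ordcd n).
  by apply: le_trans; rewrite exprS invfM; lra.
set L := (b - a) + (d - c).
have L0 : 0 <= L by rewrite /L; lra.
have [x0ab y0cd] : a <= x0 <= b /\ c <= y0 <= d by have := x0P 0; have := y0P 0.
have [H0 _ _] := H x0 y0 x0ab y0cd.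
have L1 : 0 < L ^+ 2 + 1 by rewrite ltr_wpDl// sqr_ge0.
have [|delta delta0 loc] := @mixed_diff_local _ P Q A B x0 y0 (k / 2 / (L ^+ 2 + 1)) H0.
  by rewrite !divr_gt0.
have [n Ln] : exists n, L / 2 ^+ n < delta.
  have Ld : L / delta < (Num.bound (L / delta))%:R.
    by apply: archi_boundP; rewrite divr_ge0// ltW.
  exists (Num.bound (L / delta)).
  have nP : L / delta < 2 ^+ Num.bound (L / delta).
    by apply: (lt_trans Ld); rewrite -natrX ltr_nat ltn_expl.
  rewrite ltr_pdivrMr ?exprn_gt0// mulrC -ltr_pdivrMr//.
have [h1 h2 [h3 h4] [h5 h6]] := ord n.
have p2 : 0 < (2 : R) ^- n by rewrite invr_gt0 exprn_gt0.
have M : `|mixed_diff E (a_ n) (b_ n) (c_ n) (d_ n)|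
    <= k / 2 / (L ^+ 2 + 1) * (b_ n - a_ n + (d_ n - c_ n)) ^+ 2.
  apply: loc => //.
  - move=> x y /andP[? ?] /andP[? ?].
    by have [||] := H x y; first lra; first lra.
  - apply: le_lt_trans Ln; rewrite szb ler_pM2r// /L; lra.
  - apply: le_lt_trans Ln; rewrite szd ler_pM2r// /L; lra.
have := le_trans (kn n) M; rewrite szb szd -mulrDl -/L exprMn.
have -> : ((2 : R) ^- n) ^+ 2 = (4 ^+ n)^-1.
  by rewrite exprVn -exprM mulnC exprM; congr ((_ ^+ _)^-1); ring.
rewrite mulrA ler_pM2r ?invr_gt0 ?exprn_gt0//.
by apply/negP; rewrite -ltNge mulrAC ltr_pdivrMr//; have := sqr_ge0 L; nra.
Qed.

(** * Modulus, topology and derivatives on the complex plane *)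

Section Modulus.
Variable R : realType.
Implicit Types z w : Cplane R.

Lemma normE z : `|z| = (modulus z)%:C%C.
Proof. by rewrite /modulus normc_def. Qed.

Lemma modulusE z : modulus z = Num.sqrt (complex.Re z ^+ 2 + complex.Im z ^+ 2).
Proof. by rewrite /modulus normc_def. Qed.

Lemma modulus_ge0 z : 0 <= modulus z.
Proof. by rewrite modulusE sqrtr_ge0. Qed.

Lemma sqr_modulus z : modulus z ^+ 2 = complex.Re z ^+ 2 + complex.Im z ^+ 2.
Proof. by rewrite modulusE sqr_sqrtr// addr_ge0// sqr_ge0. Qed.

Lemma modulusM z w : modulus (z * w) = modulus z * modulus w.
Proof. by apply: complexI; rewrite -normE normrM !normE -rmorphM. Qed.

Lemma modulusD z w : modulus (z + w) <= modulus z + modulus w.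
Proof. by rewrite -lecR rmorphD/= -!normE ler_normD. Qed.

Lemma modulusN z : modulus (- z) = modulus z.
Proof. by apply: complexI; rewrite -!normE normrN. Qed.

Lemma modulusB z w : modulus (z - w) = modulus (w - z).
Proof. by rewrite -modulusN opprB. Qed.

Lemma modulusV z : modulus z^-1 = (modulus z)^-1.
Proof. by apply: complexI; rewrite -normE normfV normE -fmorphV. Qed.

Lemma modulus0 : modulus (0 : Cplane R) = 0.
Proof. by apply: complexI; rewrite -normE normr0. Qed.

Lemma modulus1 : modulus (1 : Cplane R) = 1.
Proof. by apply: complexI; rewrite -normE normr1. Qed.

Lemma modulus_real (x : R) : modulus (x%:C%C : Cplane R) = `|x|.
Proof. by rewrite modulusE /= expr0n/= addr0 sqrtr_sqr. Qed.

Lemma modulus_eq0 z : (modulus z == 0) = (z == 0).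
Proof. by rewrite -(inj_eq (@complexI R)) -normE normr_eq0. Qed.

Lemma modulus_gt0 z : (0 < modulus z) = (z != 0).
Proof. by rewrite lt_neqAle modulus_ge0 eq_sym modulus_eq0 andbT. Qed.

Lemma Re_le_modulus z : `|complex.Re z| <= modulus z.
Proof. by rewrite modulusE -sqrtr_sqr ler_wsqrtr// lerDl sqr_ge0. Qed.

Lemma Im_le_modulus z : `|complex.Im z| <= modulus z.
Proof. by rewrite modulusE -sqrtr_sqr ler_wsqrtr// lerDr sqr_ge0. Qed.

Lemma modulus_le z : modulus z <= `|complex.Re z| + `|complex.Im z|.
Proof.
rewrite -[leRHS]ger0_norm ?addr_ge0// -sqrtr_sqr modulusE ler_wsqrtr//.
rewrite sqrrD !real_normK ?num_real// lerD2r lerDl.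
by rewrite mulrn_wge0// mulr_ge0.
Qed.

(** Balls of [R[i]] have radii in [R[i]]; this description has real radii. *)
Lemma nbhs_modulus z (A : set (Cplane R)) :
  nbhs z A <-> exists2 d : R, 0 < d & forall w, modulus (w - z) < d -> A w.
Proof.
split.
  move=> /nbhs_ballP[e /= e0 zA].
  have eR : e = (complex.Re e)%:C%C by rewrite RRe_real// ger0_real// ltW.
  exists (complex.Re e); first by rewrite -ltcR -eR.
  move=> w wz; apply: zA; rewrite -ball_normE/= distrC normE eR ltcR//.
move=> [d d0 dA]; apply/nbhs_ballP; exists d%:C%C; first by rewrite /= ltcR.
by move=> w; rewrite -ball_normE/= distrC normE ltcR; exact: dA.
Qed.

Lemma cvg_modulus (T : Type) (F : set_system T) (FF : Filter F)
    (f : T -> Cplane R) (l : Cplane R) :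
  f @ F --> l <-> forall e : R, 0 < e -> \forall x \near F, modulus (f x - l) < e.
Proof.
split=> [fl e e0|H].
  by apply: (fl [set w | modulus (w - l) < e]); apply/nbhs_modulus; exists e.
by move=> A /nbhs_modulus[d d0 dA]; rewrite /= ; apply: filterS (H d d0) => x; exact: dA.
Qed.

Lemma derivable_expansion (f : Cplane R -> Cplane R) (z : Cplane R) :
  derivable f z 1 -> forall eta : R, 0 < eta ->
  exists2 d : R, 0 < d & forall w, modulus (w - z) < d ->
    modulus (f w - f z - derive1 f z * (w - z)) <= eta * modulus (w - z).
Proof.
move=> df eta eta0.
have : (fun h => h^-1 *: (f (h + z) - f z)) @ 0^' --> derive1 f z.
  by move: df; rewrite derive1E /derivable /derive; under eq_fun do rewrite /= [_%:A]mulr1.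
move=> /cvg_modulus/(_ _ eta0)/nbhs_modulus[d d0 H].
exists d => // w wz; have [->|wz0] := eqVneq w z.
  by rewrite !subrr mulr0 subrr modulus0 mulr0.
have h0 : w - z != 0 by rewrite subr_eq0.
have {H} := H (w - z); rewrite subr0 subrK => /(_ wz h0) H.
have -> : f w - f z - derive1 f z * (w - z) =
   ((w - z)^-1 *: (f w - f z) - derive1 f z) * (w - z).
  by rewrite mulrBl; congr (_ - _); rewrite [_ *: _]mulrC divfK.
by rewrite modulusM ler_wpM2r ?modulus_ge0// ltW.
Qed.

Lemma derivable_shift (f : Cplane R -> Cplane R) (a z : Cplane R) :
  derivable f (a + z) 1 ->
  derivable (fun w => f (a + w)) z 1 /\ derive1 (fun w => f (a + w)) z = derive1 f (a + z).
Proof.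
rewrite /derivable !derive1E /derive /=.
by under [in X in _ -> X]eq_fun do rewrite addrCA.
Qed.
End Modulus.

(** * Cauchy's estimate *)

Lemma is_derive_primitive (R : realType) (h : R -> R) (M x : R) :
  continuous h -> - M < x < M ->
  is_derive x 1
    (fun x => (\int[@lebesgue_measure R]_(t in `[(- M), x]) h t)%R) (h x).
Proof.
move=> hc /andP[Mx xM].
have [|d e] := @continuous_FTC1_closed R h (- M) x M xM _ Mx (hc x).
  apply: continuous_compact_integrable; first exact: segment_compact.
  exact: continuous_subspaceT.
by apply: (DeriveDef d); exact: etrans (esym (derive1E _ _)) e.
Qed.

Section Square.
Variable R : realType.

(** These are the Cauchy-Riemann equations: [Im (F dw) = Im F dx + Re F dy],
    and for [F' = p + i q] both [dy (Im F)] and [dx (Re F)] are [p]. Only the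
    values of [F] near the point count, which allows [G] to be a continuous
    extension of a function with a pole. *)
Lemma closed_form_holo (F : Cplane R -> Cplane R) (G : R -> R -> Cplane R)
    (x0 y0 rho : R) :
  0 < rho ->
  (forall x y : R, `|x - x0| < rho -> `|y - y0| < rho -> G x y = F (Complex x y)) ->
  derivable F (Complex x0 y0) 1 ->
  closed_form_at (fun x y => complex.Im (G x y)) (fun x y => complex.Re (G x y)) x0 y0.
Proof.
move=> rho0 GF dF.
set D := derive1 F (Complex x0 y0).
exists (complex.Re D), (complex.Im D), (- complex.Im D) => eta eta0.
have [d d0 dE] := derivable_expansion dF eta0.
exists (Num.min rho (d / 2)); first by rewrite lt_min rho0 divr_gt0.
move=> x y; rewrite !lt_min => /andP[xr xd] /andP[yr yd].
have w0 : modulus (Complex x y - Complex x0 y0 : Cplane R) <= `|x - x0| + `|y - y0|.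
  exact: modulus_le.
have {}dE := dE _ (le_lt_trans w0 _).
have {}dE : modulus (F (Complex x y) - F (Complex x0 y0) - D * (Complex x y - Complex x0 y0))
    <= eta * (`|x - x0| + `|y - y0|).
  by apply: (le_trans (dE _)); [lra|rewrite ler_pM2l].
rewrite !GF ?subrr ?normr0//.
split.
- apply: le_trans dE; apply: le_trans (Im_le_modulus _).
  case: D => p q; case: (F _) => u v; case: (F _) => u' v' /=.
  by rewrite le_eqVlt; apply/orP; left; apply/eqP; congr `|_|; ring.
- apply: le_trans dE; apply: le_trans (Re_le_modulus _).
  case: D => p q; case: (F _) => u v; case: (F _) => u' v' /=.
  by rewrite le_eqVlt; apply/orP; left; apply/eqP; congr `|_|; ring.
Qed.

(** A form of Cauchy's integral formula. The integral of [Im (G dw)] is the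
    same around the squares of half-side [e] and [r], by Goursat's theorem on
    the four rectangles between them. Around the inner square [k / w]
    contributes at least [k] on each side, since [e / (u ^ 2 + e ^ 2)] is at
    least [1 / (2 e)] there. *)
Lemma square_annulus (G : R -> R -> Cplane R) (e r k M1 M2 : R) :
  0 < e -> e < r ->
  (forall y, continuous (fun x => complex.Im (G x y))) ->
  (forall x, continuous (fun y => complex.Re (G x y))) ->
  (forall x y : R, `|x| <= r -> `|y| <= r -> e <= `|x| \/ e <= `|y| ->
    closed_form_at (fun x y => complex.Im (G x y)) (fun x y => complex.Re (G x y)) x y) ->
  (forall x y : R, `|x| <= r -> `|y| <= r -> `|x| = r \/ `|y| = r -> modulus (G x y) <= M1) ->
  (forall x y : R, `|x| <= e -> `|y| <= e -> `|x| = e \/ `|y| = e ->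
     modulus (G x y - k%:C%C / Complex x y) <= M2) ->
  0 <= k ->
  4 * k <= 8 * r * M1 + 8 * e * M2.
Proof.
move=> e0 er cI cR Gcl G1 G2 k0.
pose P x y := complex.Im (G x y); pose Q x y := complex.Re (G x y).
pose A x y := (\int[@lebesgue_measure R]_(t in `[(- (r + 1)), x]) P t y)%R.
pose B x y := (\int[@lebesgue_measure R]_(t in `[(- (r + 1)), y]) Q x t)%R.
have dA x y : - r <= x <= r -> is_derive x 1 (A ^~ y) (P x y).
  move=> /andP[? ?].
  by apply: (@is_derive_primitive _ (P ^~ y)); [exact: cI|apply/andP; split; lra].
have dB x y : - r <= y <= r -> is_derive y 1 (B x) (Q x y).
  move=> /andP[? ?].
  by apply: (@is_derive_primitive _ (Q x)); [exact: cR|apply/andP; split; lra].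
clearbody A B.
pose E x y := A x y - B x y.
have Gz a b c d : - r <= a <= b -> b <= r -> - r <= c <= d -> d <= r ->
  (forall x y : R, a <= x <= b -> c <= y <= d -> e <= `|x| \/ e <= `|y|) ->
  mixed_diff E a b c d = 0.
  move=> /andP[? ?] ? /andP[? ?] ? H; apply: (@goursat _ P Q A B); [lra|lra|] => x y hx hy.
  have [? ?] : - r <= x <= r /\ - r <= y <= r.
    by move: hx hy => /andP[? ?] /andP[? ?]; split; apply/andP; split; lra.
  split; [|exact: dA|exact: dB].
  by apply: Gcl; rewrite ?ler_norml //; exact: H hx hy.
have rN : - r < - e by rewrite ltrN2.
have r0 : 0 < r by exact: lt_trans er.
have [rr ee] : - r < r /\ - e < e by rewrite !gtrN// ?(lt_trans e0).
have big_pos (x : R) u : e <= x <= u -> e <= `|x|.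
  by move=> /andP[ex _]; exact: le_trans (ler_norm x).
have big_neg (x : R) u : u <= x <= - e -> e <= `|x|.
  by move=> /andP[_ ex]; rewrite -normrN; apply: le_trans (ler_norm _); rewrite lerNr.
have split5 : mixed_diff E (- r) r (- r) r = mixed_diff E (- e) e (- e) e.
  have -> : mixed_diff E (- r) r (- r) r =
    mixed_diff E (- r) (- e) (- r) r + mixed_diff E e r (- r) r +
    mixed_diff E (- e) e (- r) (- e) + mixed_diff E (- e) e e r +
    mixed_diff E (- e) e (- e) e by rewrite /mixed_diff; ring.
  have -> : mixed_diff E (- r) (- e) (- r) r = 0.
    apply: Gz; rewrite ?lexx ?(ltW rN) ?(ltW rr) ?(ltW (lt_trans ee er))//.
    by move=> x y /big_neg; left.
  have -> : mixed_diff E e r (- r) r = 0.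
    apply: Gz; rewrite ?lexx ?(ltW rN) ?(ltW rr) ?(ltW er) ?(ltW (lt_trans rN ee))//.
    by move=> x y /big_pos; left.
  have -> : mixed_diff E (- e) e (- r) (- e) = 0.
    apply: Gz; rewrite ?lexx ?(ltW rN) ?(ltW ee) ?(ltW er) ?(ltW (lt_trans ee er))//.
    by move=> x y _ /big_neg; right.
  have -> : mixed_diff E (- e) e e r = 0.
    apply: Gz; rewrite ?lexx ?(ltW rN) ?(ltW ee) ?(ltW er) ?(ltW (lt_trans rN ee))//.
    by move=> x y _ /big_pos; right.
  by rewrite !add0r.
have edges s : 0 < s <= r -> exists x1 x2 y1 y2,
  [/\ [/\ - s <= x1 <= s, - s <= x2 <= s, - s <= y1 <= s & - s <= y2 <= s] &
  mixed_diff E (- s) s (- s) s =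
   (P x1 (- s) - P x2 s + Q s y1 - Q (- s) y2) * (2 * s)].
  move=> /andP[s0 sr].
  have ss : - s <= s by lra.
  have sub x : - s <= x <= s -> - r <= x <= r.
    by move=> /andP[? ?]; apply/andP; split; lra.
  have [x1 [h1 e1]] := mvt_is_derive ss (fun t ht => dA t (- s) (sub t ht)).
  have [x2 [h2 e2]] := mvt_is_derive ss (fun t ht => dA t s (sub t ht)).
  have [y1 [h3 e3]] := mvt_is_derive ss (fun t ht => dB s t (sub t ht)).
  have [y2 [h4 e4]] := mvt_is_derive ss (fun t ht => dB (- s) t (sub t ht)).
  exists x1, x2, y1, y2; split => //.
  have -> : 2 * s = s - - s by ring.
  rewrite !mulrDl !mulNr -e1 -e2 -e3 -e4 /mixed_diff /E; ring.
have nn (x s : R) : - s <= x <= s -> `|x| <= s by rewrite ler_norml.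
have up : mixed_diff E (- r) r (- r) r <= 8 * r * M1.
  have [|x1 [x2 [y1 [y2 [[/nn h1 /nn h2 /nn h3 /nn h4] ->]]]]] := edges r.
    by apply/andP; split; lra.
  have r0' : `|r| = r by rewrite ger0_norm; lra.
  have rN' : `|- r| = r by rewrite normrN.
  have := le_trans (Im_le_modulus _) (G1 x1 (- r) h1 ltac:(by rewrite rN') (or_intror rN')).
  have := le_trans (Im_le_modulus _) (G1 x2 r h2 ltac:(by rewrite r0') (or_intror r0')).
  have := le_trans (Re_le_modulus _) (G1 r y1 ltac:(by rewrite r0') h3 (or_introl r0')).
  have := le_trans (Re_le_modulus _) (G1 (- r) y2 ltac:(by rewrite rN') h4 (or_introl rN')).
  rewrite !ler_norml /P /Q => /andP[? ?] /andP[? ?] /andP[? ?] /andP[? ?].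
  have -> : 8 * r * M1 = (4 * M1) * (2 * r) by ring.
  by rewrite ler_pM2r; lra.
have low : 4 * k - 8 * e * M2 <= mixed_diff E (- e) e (- e) e.
  have [|x1 [x2 [y1 [y2 [[/nn h1 /nn h2 /nn h3 /nn h4] ->]]]]] := edges e.
    by apply/andP; split; lra.
  have r0' : `|e| = e by rewrite ger0_norm; lra.
  have rN' : `|- e| = e by rewrite normrN.
  have inv (u : R) : `|u| <= e -> (2 * e)^-1 <= e / (u ^+ 2 + e ^+ 2).
    rewrite ler_norml => /andP[? ?].
    have ? : 0 < u ^+ 2 + e ^+ 2 by rewrite ltr_wpDl ?sqr_ge0// exprn_gt0.
    rewrite ler_pdivlMr// mulrC ler_pdivrMr; nra.
  have := le_trans (Im_le_modulus _) (G2 x1 (- e) h1 ltac:(by rewrite rN') (or_intror rN')).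
  have := le_trans (Im_le_modulus _) (G2 x2 e h2 ltac:(by rewrite r0') (or_intror r0')).
  have := le_trans (Re_le_modulus _) (G2 e y1 ltac:(by rewrite r0') h3 (or_introl r0')).
  have := le_trans (Re_le_modulus _) (G2 (- e) y2 ltac:(by rewrite rN') h4 (or_introl rN')).
  have i1 := inv _ h1; have i2 := inv _ h2; have i3 := inv _ h3; have i4 := inv _ h4.
  have Re_inv (u v : R) (z : Cplane R) : complex.Re (z - k%:C%C / Complex u v)
     = complex.Re z - k * (u / (u ^+ 2 + v ^+ 2)).
    by case: z => a b /=; ring.
  have Im_inv (u v : R) (z : Cplane R) : complex.Im (z - k%:C%C / Complex u v)
     = complex.Im z + k * (v / (u ^+ 2 + v ^+ 2)).
    by case: z => a b /=; ring.
  rewrite !ler_norml !Re_inv !Im_inv -/(P _ _) -/(P _ _) -/(Q _ _) -/(Q _ _).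
  rewrite !sqrrN ![e ^+ 2 + _]addrC !mulNr !mulrN.
  have {}i1 := ler_wpM2l k0 i1; have {}i2 := ler_wpM2l k0 i2.
  have {}i3 := ler_wpM2l k0 i3; have {}i4 := ler_wpM2l k0 i4.
  move=> /andP[? ?] /andP[? ?] /andP[? ?] /andP[? ?].
  have -> : 4 * k - 8 * e * M2 = (4 * (k * (2 * e)^-1) - 4 * M2) * (2 * e) by field; lra.
  by rewrite ler_pM2r; lra.
by rewrite split5 in up; lra.
Qed.
End Square.

Section Cauchy.
Variable R : realType.

Lemma continuous_Complex (T : topologicalType) (u v : T -> R) :
  continuous u -> continuous v ->
  continuous (fun t => Complex (u t) (v t) : Cplane R).
Proof.
move=> uc vc t; apply/cvg_modulus => e e0.
have e2 : 0 < e / 2 by rewrite divr_gt0.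
have /cvgrPdist_lt/(_ _ e2) U := uc t.
have /cvgrPdist_lt/(_ _ e2) V := vc t.
near=> s; apply: (le_lt_trans (modulus_le _)) => /=.
rewrite [e]splitr ltrD// distrC; near: s; [exact: U|exact: V].
Unshelve. all: by end_near. Qed.

Lemma continuous_Re : continuous (fun z : Cplane R => complex.Re z).
Proof.
move=> z; apply: (@cvgrPdist_lt _ _ _ _ (nbhs_filter z) _ _).2 => e e0.
apply/nbhs_modulus; exists e => // w wz; rewrite distrC.
by apply: le_lt_trans wz; have := Re_le_modulus (w - z); case: (w) (z) => ? ? [? ?].
Qed.

Lemma continuous_Im : continuous (fun z : Cplane R => complex.Im z).
Proof.
move=> z; apply: (@cvgrPdist_lt _ _ _ _ (nbhs_filter z) _ _).2 => e e0.
apply/nbhs_modulus; exists e => // w wz; rewrite distrC.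
by apply: le_lt_trans wz; have := Im_le_modulus (w - z); case: (w) (z) => ? ? [? ?].
Qed.

Definition clamp (r x : R) : R := Num.max (- r) (Num.min x r).

Lemma clamp_id r x : `|x| <= r -> clamp r x = x.
Proof.
by rewrite ler_norml /clamp => /andP[h1 h2]; rewrite (min_idPl h2) (max_idPr h1).
Qed.

Lemma clamp_le r x : 0 <= r -> `|clamp r x| <= r.
Proof.
move=> r0; rewrite ler_norml /clamp le_max lexx/= ge_max ge_min lexx orbT andbT.
by rewrite (le_trans _ r0)// oppr_le0.
Qed.

Lemma continuous_clamp r : continuous (clamp r).
Proof.
move=> x; apply: (@continuous_max _ _ (fun=> - r) (fun x => Num.min x r)).
  exact: cvg_cst.
by apply: (@continuous_min _ _ id (fun=> r)); [exact: cvg_id|exact: cvg_cst].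
Qed.

(** This is [1 / (x + i y)] where [x ^ 2 + y ^ 2 >= e], and it remains
    continuous at the origin. *)
Definition reg_inv (e x y : R) : Cplane R :=
  let n := Num.max (x ^+ 2 + y ^+ 2) e in Complex (x / n) (- (y / n)).

Lemma reg_inv_id e x y : e <= x ^+ 2 + y ^+ 2 -> reg_inv e x y = (Complex x y)^-1.
Proof. by move=> h; rewrite /reg_inv (max_idPl h). Qed.

Lemma continuous_reg_inv (T : topologicalType) e (u v : T -> R) : 0 < e ->
  continuous u -> continuous v -> continuous (fun t => reg_inv e (u t) (v t)).
Proof.
move=> e0 uc vc.
have nc : continuous (fun t => (Num.max (u t ^+ 2 + v t ^+ 2) e)^-1).
  move=> t; apply: cvgV; first by rewrite gt_eqF// lt_max e0 orbT.
  apply: (@continuous_max _ _ (fun t => u t ^+ 2 + v t ^+ 2) (fun=> e)); last exact: cvg_cst.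
  by apply: cvgD; [exact: cvgM (uc t) (uc t)|exact: cvgM (vc t) (vc t)].
apply: continuous_Complex => t; first exact: cvgM (uc t) (nc t).
by apply: cvgN; exact: cvgM (vc t) (nc t).
Qed.
End Cauchy.

Section CauchyEstimate.
Variable R : realType.

Lemma derivable_Cplane_continuous (g : Cplane R -> Cplane R) z :
  derivable g z 1 -> {for z, continuous g}.
Proof. by move=> dg; apply/differentiable_continuous/derivable1_diffP. Qed.

Lemma derivable_inv (z : Cplane R) : z != 0 ->
  derivable (fun w : Cplane R => w^-1 : Cplane R) z 1.
Proof.
move=> z0; have did : derivable (id : Cplane R -> Cplane R) z 1 by exact: derivable_id.
exact: (@derivableV _ _ (id : Cplane R -> Cplane R) z 1 z0 did).
Qed.

Lemma modulus_conjc (z : Cplane R) : modulus (conjc z : Cplane R) = modulus z.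
Proof. by rewrite !modulusE; case: z => p q /=; rewrite sqrrN. Qed.

Lemma mul_conjc (z : Cplane R) : conjc z * z = (modulus z ^+ 2)%:C%C.
Proof.
rewrite sqr_modulus; case: z => p q; apply/eqP; rewrite eq_complex /=.
by apply/andP; split; apply/eqP; ring.
Qed.

(** The function [k * g w / w ^ 2] on a square annulus, made continuous on the
    whole plane so that it has primitives along all horizontal and vertical
    lines. *)
Definition kernel_extension (k : Cplane R) (g : Cplane R -> Cplane R) (s e x y : R) : Cplane R :=
  k * (g (Complex (clamp s x) (clamp s y)) * (reg_inv e x y * reg_inv e x y)).

Lemma continuous_kernel_extension (T : topologicalType) (k : Cplane R)
    (g : Cplane R -> Cplane R) (s e : R) (u v : T -> R) :
  0 <= s -> 0 < e ->
  (forall w, modulus w <= 2 * s -> derivable g w 1) ->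
  continuous u -> continuous v ->
  continuous (fun t => kernel_extension k g s e (u t) (v t)).
Proof.
move=> s0 e0 dg uc vc t.
have cc (h : T -> R) : continuous h -> continuous (fun t => clamp s (h t)).
  move=> hc x; apply: (@continuous_comp _ _ _ h (clamp s)); first exact: hc.
  exact: continuous_clamp.
apply: cvgM; first exact: cvg_cst.
apply: cvgM; last by apply: cvgM; exact: continuous_reg_inv.
apply: (@continuous_comp _ _ _ (fun t => Complex (clamp s (u t)) (clamp s (v t)) : Cplane R) g).
  by apply: continuous_Complex; exact: cc.
apply: derivable_Cplane_continuous; apply: dg.
by apply: (le_trans (modulus_le _)) => /=; rewrite mulr2n mulrDl !mul1r lerD// clamp_le.
Qed.

Lemma kernel_extensionE k g (s e x y : R) : `|x| <= s -> `|y| <= s ->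
  e <= x ^+ 2 + y ^+ 2 ->
  kernel_extension k g s e x y = k * (g (Complex x y) * ((Complex x y)^-1 * (Complex x y)^-1)).
Proof. by move=> xs ys h; rewrite /kernel_extension !clamp_id// reg_inv_id. Qed.

(** With [D = g' 0], the function [conj D * g w / w ^ 2] is close to
    [|D| ^ 2 / w] near [0] and at most [|D| / |w| ^ 2] elsewhere, so that
    [square_annulus] compares [|D| ^ 2] with [|D|]. *)
Lemma cauchy_estimate0 (g : Cplane R -> Cplane R) (d : R) : 0 < d ->
  (forall w, modulus w < d -> derivable g w 1 /\ modulus (g w) <= 1) ->
  g 0 = 0 -> modulus (derive1 g 0) <= 16 / d.
Proof.
move=> d0 Hg g0; set D := derive1 g 0; pose m := modulus D.
have dg w : modulus w < d -> derivable g w 1 by move=> /Hg[].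
have m0 : 0 <= m by exact: modulus_ge0.
pose k : Cplane R := conjc D.
have km : modulus k = m by exact: modulus_conjc.
have kD : k * D = (m ^+ 2)%:C%C by exact: mul_conjc.
pose r := d / 4.
have r0 : 0 < r by rewrite divr_gt0.
have dg0 : derivable g 0 1 by apply: dg; rewrite modulus0.
have rV0 : 0 < r^-1 by rewrite invr_gt0.
(* With precision 1 / r the error on the inner square has the size 8 m / r of
   the bound on the outer one. *)
have [dl dl0 gE] := derivable_expansion dg0 rV0.
have [mn0 mnr mnd] : [/\ 0 < Num.min r dl, Num.min r dl <= r & Num.min r dl <= dl].
  by rewrite lt_min r0 dl0 !ge_min !lexx orbT.
pose e := Num.min r dl / 4.
have e0 : 0 < e by rewrite divr_gt0.
have er : e < r by rewrite /e; lra.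
have edl : 2 * e < dl by rewrite /e; lra.
have er4 : e <= r / 4 by rewrite /e; lra.
(* Between r and d / 2: near the square of half-side r clamping does nothing,
   and the clamped points stay in the disc of radius d. *)
pose s := 3 * d / 8.
have s0 : 0 <= s by rewrite /s; lra.
have ee0 : 0 < e ^+ 2 / 4 by rewrite divr_gt0// exprn_gt0.
have ds w : modulus w <= 2 * s -> derivable g w 1.
  by move=> h; apply: dg; apply: (le_lt_trans h); rewrite /s; lra.
have sq_ge (t x y : R) : 0 <= t -> t <= `|x| \/ t <= `|y| -> t ^+ 2 <= x ^+ 2 + y ^+ 2.
  move=> t0 [h|h]; rewrite -[x ^+ 2]real_normK ?num_real// -[y ^+ 2]real_normK ?num_real//.
    by apply: (@le_trans _ _ (`|x| ^+ 2)); rewrite ?lerXn2r ?nnegrE// lerDl sqr_ge0.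
  by apply: (@le_trans _ _ (`|y| ^+ 2)); rewrite ?lerXn2r ?nnegrE// lerDr sqr_ge0.
have mod_ge (t x y : R) : 0 <= t -> t <= `|x| \/ t <= `|y| -> t <= modulus (Complex x y).
  move=> t0 h; rewrite -(@ler_pXn2r _ 2) ?nnegrE ?modulus_ge0// sqr_modulus.
  exact: sq_ge.
pose G := kernel_extension k g s (e ^+ 2 / 4).
have GE x y : `|x| <= r -> `|y| <= r -> e / 2 <= `|x| \/ e / 2 <= `|y| ->
    G x y = k * (g (Complex x y) * ((Complex x y)^-1 * (Complex x y)^-1)).
  move=> xr yr h; apply: kernel_extensionE.
  - by apply: (le_trans xr); rewrite /r /s; lra.
  - by apply: (le_trans yr); rewrite /r /s; lra.
  - have -> : e ^+ 2 / 4 = (e / 2) ^+ 2 by field.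
    by apply: sq_ge => //; lra.
have : 4 * m ^+ 2 <= 8 * r * (m / r ^+ 2) + 8 * e * (m * r^-1 / e).
  apply: (@square_annulus _ G e r) => //.
  - move=> y x; apply: (@continuous_comp _ _ _ (G ^~ y) (@complex.Im R)); last exact: continuous_Im.
    apply: continuous_kernel_extension => //; last by move=> ?; exact: cvg_cst.
    by move=> ?; exact: cvg_id.
  - move=> x y; apply: (@continuous_comp _ _ _ (G x) (@complex.Re R)); last exact: continuous_Re.
    apply: continuous_kernel_extension => //; first by move=> ?; exact: cvg_cst.
    by move=> ?; exact: cvg_id.
  - move=> x y xr yr exy.
    apply: (@closed_form_holo _
      (fun w => k * (g w * (w^-1 * w^-1))) _ _ _ (e / 2)); first lra.
      move=> x' y' hx hy; apply: kernel_extensionE.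
      + have := ler_normD x (x' - x); rewrite addrC subrK => h.
        by rewrite /s; move: xr hx er4 r0; rewrite /r; lra.
      + have := ler_normD y (y' - y); rewrite addrC subrK => h.
        by rewrite /s; move: yr hy er4 r0; rewrite /r; lra.
      + have -> : e ^+ 2 / 4 = (e / 2) ^+ 2 by field.
        apply: sq_ge; first lra.
        case: exy => h; [left|right].
          by have := ler_distD x' x 0; rewrite !subr0 distrC; lra.
        by have := ler_distD y' y 0; rewrite !subr0 distrC; lra.
    have w0 : (Complex x y : Cplane R) != 0.
      by rewrite -modulus_gt0; apply: (lt_le_trans e0); apply: mod_ge => //; exact: ltW.
    apply: derivableM; first exact: derivable_cst.
    apply: derivableM.
      apply: dg; apply: (le_lt_trans (modulus_le _)) => /=.
      by move: xr yr; rewrite /r; lra.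
    by apply: derivableM; exact: derivable_inv.
  - move=> x y xr yr h.
    have h' : r <= `|x| \/ r <= `|y| by case: h => ->; [left|right].
    rewrite GE//; last by case: h' => h'; [left|right]; lra.
    rewrite !modulusM !modulusV km -invfM -expr2.
    apply: ler_wpM2l => //.
    have M1 : modulus (g (Complex x y)) <= 1.
      apply: (Hg _ _).2; apply: (le_lt_trans (modulus_le _)) => /=.
      by move: xr yr; rewrite /r; lra.
    have Mr : r <= modulus (Complex x y) by apply: mod_ge => //; exact: ltW.
    have Mp : 0 < modulus (Complex x y) by exact: lt_le_trans Mr.
    rewrite -[leRHS]mul1r; apply: ler_pM; rewrite ?modulus_ge0// ?invr_ge0 ?sqr_ge0//.
    by rewrite lef_pV2 ?posrE ?exprn_gt0// lerXn2r// nnegrE ltW.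
  - move=> x y xr yr h.
    have h' : e <= `|x| \/ e <= `|y| by case: h => ->; [left|right].
    rewrite GE//; [|lra|lra|by case: h' => h'; [left|right]; lra].
    have Mr : e <= modulus (Complex x y) by apply: mod_ge => //; exact: ltW.
    have Mp : 0 < modulus (Complex x y) by exact: lt_le_trans Mr.
    set w : Cplane R := Complex x y in Mr Mp *.
    have w0 : w != 0 by rewrite -modulus_gt0.
    have -> : k * (g w * (w^-1 * w^-1)) - (m ^+ 2)%:C%C / w = k * ((g w - D * w) * (w^-1 * w^-1)).
      by rewrite -kD; field.
    rewrite !modulusM !modulusV km -mulrA; apply: ler_wpM2l => //.
    have : modulus (g w - D * w) <= r^-1 * modulus w.
      have := gE w; rewrite g0 !subr0; apply.
      by apply: (le_lt_trans (modulus_le _)); rewrite /w /=; lra.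
    move=> H; apply: (@le_trans _ _ (r^-1 * modulus w * ((modulus w)^-1 * (modulus w)^-1))).
      by apply: ler_wpM2r => //; rewrite mulr_ge0// invr_ge0 ltW.
    rewrite -mulrA mulVKf ?gt_eqF// ler_pM2l ?invr_gt0//.
    by rewrite lef_pV2 ?posrE.
  - by rewrite sqr_ge0.
have -> : 8 * r * (m / r ^+ 2) + 8 * e * (m * r^-1 / e) = 16 / r * m by field; rewrite !gt_eqF.
rewrite -/m; have [->|mneq0] := eqVneq m 0; first by move=> _; rewrite divr_ge0// ltW.
rewrite expr2 mulrA ler_pM2r ?lt_neqAle 1?eq_sym ?mneq0//.
have -> : 16 / r = 4 * (16 / d) by rewrite /r; field; rewrite gt_eqF.
by rewrite ler_pM2l.
Qed.

Lemma cauchy_estimate (f : Cplane R -> Cplane R) (z : Cplane R) (d : R) : 0 < d ->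
  (forall w, modulus (w - z) < d -> derivable f w 1 /\ modulus (f w) <= 1) ->
  f z = 0 -> modulus (derive1 f z) <= 16 / d.
Proof.
move=> d0 H fz.
have zz : modulus (z + 0 - z) < d by rewrite addr0 subrr modulus0.
have [_] := derivable_shift (H _ zz).1; rewrite addr0 => <-.
apply: cauchy_estimate0 => //; last by rewrite addr0.
move=> w wd.
have zw : modulus (z + w - z) < d by rewrite [z + w]addrC addrK.
have [h1 h2] := H _ zw.
have [h3 _] := derivable_shift h1.
exact: (conj h3 h2).
Qed.
End CauchyEstimate.

(** * Bounds on the density from discs inside and outside a domain *)

Section Caratheodory.
Variable R : realType.
Implicit Types (D : set (Cplane R)) (z w : Cplane R).

Lemma is_derive_mulC (u v : Cplane R -> Cplane R) (w du dv : Cplane R) :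
  is_derive w 1 u du -> is_derive w 1 v dv ->
  is_derive w 1 (fun w => u w * v w : Cplane R) (u w * dv + v w * du).
Proof. by move=> hu hv; exact: (@is_deriveM _ _ u v w 1 du dv hu hv). Qed.

Lemma is_derive_invC (u : Cplane R -> Cplane R) (w du : Cplane R) :
  u w != 0 -> is_derive w 1 u du ->
  is_derive w 1 (fun w => (u w)^-1 : Cplane R) (- (u w) ^- 2 * du).
Proof.
move=> u0 [h1 h2]; apply: DeriveDef; first exact: (@derivableV _ _ u w 1 u0 h1).
by rewrite (@deriveV _ _ u w 1 u0 h1) h2.
Qed.

Lemma is_derive_cstC (c w : Cplane R) : is_derive w 1 (fun _ : Cplane R => c) 0.
Proof. exact: (is_derive_cst c). Qed.

Lemma is_derive_subC (u v : Cplane R -> Cplane R) (w du dv : Cplane R) :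
  is_derive w 1 u du -> is_derive w 1 v dv ->
  is_derive w 1 (fun w => u w - v w : Cplane R) (du - dv).
Proof. by move=> hu hv; exact: (@is_deriveB _ _ _ u v w 1 du dv hu hv). Qed.

Lemma is_derive_idC (w : Cplane R) : is_derive w 1 (fun w : Cplane R => w) 1.
Proof. exact: (is_derive_id w 1). Qed.

Lemma caratheodory_le D z (d : R) : 0 < d ->
  (forall w, modulus (w - z) < d -> D w) ->
  (caratheodory D z <= (16 / d)%:E)%E.
Proof.
move=> d0 zD; apply: ge_ereal_sup => _ [f [fD fdisc fz] <-].
rewrite lee_fin; apply: cauchy_estimate => // w /zD Dw.
split; first exact: fD.
by apply: ltW; apply: fdisc; exists w.
Qed.

Lemma blaschke_lt1 (a b : Cplane R) : modulus a < 1 -> modulus b < 1 ->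
  modulus ((b - a) / (1 - conjc a * b)) < 1.
Proof.
move=> a1 b1.
have a2 : modulus a ^+ 2 < 1 by rewrite expr_lt1// modulus_ge0.
have b2 : modulus b ^+ 2 < 1 by rewrite expr_lt1// modulus_ge0.
have dif : modulus (b - a) ^+ 2 < modulus (1 - conjc a * b : Cplane R) ^+ 2.
  move: a2 b2; rewrite !sqr_modulus; case: (a) => p q; case: (b) => u v /=.
  move=> h1 h2; rewrite -subr_gt0.
  have : 0 < (1 - (p ^+ 2 + q ^+ 2)) * (1 - (u ^+ 2 + v ^+ 2)) by rewrite mulr_gt0// subr_gt0.
  by congr (0 < _); ring.
have n0 : 0 < modulus (1 - conjc a * b : Cplane R).
  rewrite lt_neqAle modulus_ge0 andbT eq_sym -sqrf_eq0.
  by rewrite gt_eqF// (le_lt_trans _ dif)// sqr_ge0.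
rewrite modulusM modulusV ltr_pdivrMr// mul1r.
by rewrite -(@ltr_pXn2r _ 2) ?nnegrE ?modulus_ge0.
Qed.

(** The Blaschke factor that sends [f z] to [0] multiplies the derivative at
    [z] by [1 / (1 - |f z| ^ 2)]. *)
Lemma caratheodory_ge D z (f : Cplane R -> Cplane R) : D z ->
  holomorphic_on D f -> f @` D `<=` @unit_disc R ->
  ((modulus (derive1 f z) / (1 - modulus (f z) ^+ 2))%:E <= caratheodory D z)%E.
Proof.
move=> Dz fD fdisc.
have f1 w : D w -> modulus (f w) < 1 by move=> Dw; apply: fdisc; exists w.
set a := f z.
pose N w : Cplane R := 1 - conjc a * f w.
have N0 w : D w -> N w != 0.
  move=> Dw; rewrite subr_eq0; apply/negP => /eqP h.
  have : modulus (conjc a * f w : Cplane R) < 1.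
    rewrite modulusM modulus_conjc.
    have := f1 _ Dz; have := f1 _ Dw; have := modulus_ge0 (f w); have := modulus_ge0 a.
    by rewrite -/a; nra.
  by rewrite -h modulus1 ltxx.
have isf w : D w -> is_derive w 1 f ('D_1 f w) by move=> /fD ?; apply: DeriveDef.
have isN w : D w -> is_derive w 1 N (- (conjc a * 'D_1 f w)).
  move=> Dw; have h := is_derive_subC (is_derive_cstC 1 w)
    (is_derive_mulC (is_derive_cstC (conjc a) w) (isf w Dw)).
  by rewrite mulr0 addr0 sub0r in h.
pose phi w : Cplane R := (f w - a) / N w.
have isphi w : D w -> is_derive w 1 phi
   ((f w - a) * (- (N w) ^- 2 * (- (conjc a * 'D_1 f w))) + (N w)^-1 * 'D_1 f w).
  move=> Dw; have h := is_derive_mulC (is_derive_subC (isf w Dw) (is_derive_cstC a w))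
    (is_derive_invC (N0 w Dw) (isN w Dw)).
  by rewrite subr0 in h.
apply: ereal_sup_ubound; exists phi.
  split.
  - by move=> w Dw; have [] := isphi w Dw.
  - by move=> _ [w Dw <-]; exact: blaschke_lt1 (f1 _ Dz) (f1 _ Dw).
  - by rewrite /phi subrr mul0r.
congr (_%:E); have [_] := isphi z Dz; rewrite -/a subrr mul0r add0r derive1E => ->.
have -> : N z = (1 - modulus a ^+ 2)%:C%C.
  by rewrite /N -/a mul_conjc rmorphB/=.
have ? : 0 < 1 - modulus a ^+ 2.
  by rewrite subr_gt0 expr_lt1 ?modulus_ge0//; exact: f1.
rewrite modulusM modulusV modulus_real gtr0_norm//.
by rewrite mulrC derive1E.
Qed.

(** The test function is [r / (w - q)]. The factor
    [1 / (1 - |f z| ^ 2)] of [caratheodory_ge] is what makes the bound blow up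
    when [z] approaches the disc. *)
Lemma caratheodory_exterior_disc D z (q : Cplane R) (r : R) : D z -> 0 < r ->
  (forall w, D w -> r < modulus (w - q)) ->
  ((r / (modulus (z - q) ^+ 2 - r ^+ 2))%:E <= caratheodory D z)%E.
Proof.
move=> Dz r0 Dq.
pose f w : Cplane R := r%:C%C * (w - q)^-1.
have isf w : D w -> is_derive w 1 f (r%:C%C * - (w - q) ^- 2).
  move=> Dw.
  have wq : w - q != 0 by rewrite -modulus_gt0 (lt_trans r0)// Dq.
  have := is_derive_mulC (is_derive_cstC r%:C%C w) (@is_derive_invC (fun w => w - q) w _ wq
    (is_derive_subC (is_derive_idC w) (is_derive_cstC q w))).
  by rewrite subr0 !mulr0 addr0 mulr1.
have Mf w : modulus (f w) = r / modulus (w - q).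
  by rewrite modulusM modulusV modulus_real gtr0_norm.
have := @caratheodory_ge D z f Dz _ _.
have [_] := isf z Dz; rewrite -derive1E => ->.
rewrite Mf modulusM modulusN modulusV modulus_real gtr0_norm//.
have zq := Dq z Dz; set m := modulus (z - q) in zq *.
have m0 : 0 < m by exact: lt_trans zq.
have -> : modulus ((z - q) ^+ 2) = m ^+ 2 by rewrite expr2 modulusM -expr2.
have -> : r / m ^+ 2 / (1 - (r / m) ^+ 2) = r / (m ^+ 2 - r ^+ 2).
  by field; rewrite !gt_eqF// subr_gt0 ltrXn2r// ltW.
apply.
  by move=> w Dw; have [] := isf w Dw.
move=> _ [w Dw <-]; rewrite /unit_disc/= Mf ltr_pdivrMr ?mul1r ?Dq//.
by rewrite (lt_trans r0)// Dq.
Qed.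

Lemma caratheodory_bounded D z (M : R) : D z -> 0 < M ->
  (forall w, D w -> modulus (w - z) < M) ->
  ((M^-1)%:E <= caratheodory D z)%E.
Proof.
move=> Dz M0 DM.
pose f w : Cplane R := (M^-1)%:C%C * (w - z).
have isf w : is_derive w 1 f ((M^-1)%:C%C).
  have := is_derive_mulC (is_derive_cstC (M^-1)%:C%C w)
    (is_derive_subC (is_derive_idC w) (is_derive_cstC z w)).
  by rewrite subr0 !mulr0 addr0 mulr1.
apply: ereal_sup_ubound; exists f.
  split.
  - by move=> w _; have [] := isf w.
  - move=> _ [w Dw <-]; rewrite /unit_disc/= /f modulusM modulus_real gtr0_norm ?invr_gt0//.
    by rewrite mulrC ltr_pdivrMr// mul1r DM.
  - by rewrite /f subrr mulr0.
have [_] := isf z; rewrite -derive1E => ->.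
by rewrite modulus_real gtr0_norm// invr_gt0.
Qed.
End Caratheodory.

(** * Exterior discs at smooth boundaries *)

Section Taylor.
Variable R : realType.
Implicit Types (f : R * R -> R) (p q h x : R * R).

Let e1 : R * R := (1, 0).
Let e2 : R * R := (0, 1).

Definition box p (d : R) : set (R * R) :=
  [set x | `|x.1 - p.1| < d /\ `|x.2 - p.2| < d].

Lemma nbhs_box p (A : set (R * R)) : nbhs p A -> exists2 d : R, 0 < d & box p d `<=` A.
Proof.
move=> /nbhs_ballP[d d0 dA]; exists d => // x [x1 x2]; apply: dA.
by split; rewrite /ball/= distrC.
Qed.

Lemma box_nbhs p (d : R) : 0 < d -> nbhs p (box p d).
Proof.
move=> d0; apply/nbhs_ballP; exists d => // x [x1 x2].
by split; rewrite distrC.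
Qed.

Lemma derive_partials f x h : differentiable f x ->
  'D_h f x = h.1 * 'D_e1 f x + h.2 * 'D_e2 f x.
Proof.
move=> df; rewrite !deriveE//.
have hE : h = h.1 *: e1 + h.2 *: e2.
  by apply: injective_projections; rewrite /= /GRing.scale/= ?mulr1 ?mulr0 ?addr0 ?add0r.
have lin (L : {linear (R * R)%type -> R}) : L h = h.1 * L e1 + h.2 * L e2.
  by rewrite {1}hE linearD !linearZ.
exact: lin.
Qed.

Lemma is_derive_line f q h (t : R) : differentiable f (q + t *: h) ->
  is_derive t 1 (fun s : R => f (q + s *: h))
   (h.1 * 'D_e1 f (q + t *: h) + h.2 * 'D_e2 f (q + t *: h)).
Proof.
move=> df; rewrite -derive_partials//.
have E : (fun u : R => u^-1 *: ((fun s : R => f (q + s *: h)) (u *: 1 + t) - f (q + t *: h)))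
   = (fun u : R => u^-1 *: (f (u *: h + (q + t *: h)) - f (q + t *: h))).
  by apply/funext => u; rewrite [_%:A]mulr1 scalerDl addrCA.
have [h1 h2] := derivableP (diff_derivable (v := h) df).
apply: DeriveDef.
  by move: h1; rewrite /derivable /= -E.
by move: h2; rewrite /derive /= -E.
Qed.

Lemma box_line p q h (d t : R) : 0 <= t <= 1 ->
  box p d q -> box p d (q + h) -> box p d (q + t *: h).
Proof.
move=> /andP[t0 t1].
have conv (a b c : R) : `|a - c| < d -> `|a + b - c| < d -> `|a + t * b - c| < d.
  move=> h1 h2; pose m := Num.max `|a - c| `|a + b - c|.
  have md : m < d by rewrite /m gt_max h1.
  have -> : a + t * b - c = (1 - t) * (a - c) + t * (a + b - c) by ring.
  apply: le_lt_trans md; apply: (le_trans (ler_normD _ _)).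
  rewrite !normrM (ger0_norm t0) (ger0_norm (_ : 0 <= 1 - t)) ?subr_ge0//.
  have -> : m = (1 - t) * m + t * m by ring.
  by apply: lerD; apply: ler_wpM2l; rewrite ?subr_ge0// /m le_max lexx ?orbT.
by move=> [h1 h2] [h3 h4]; split; apply: conv.
Qed.

Lemma mvt_box f p q h (d : R) :
  (forall x, box p d x -> differentiable f x) ->
  box p d q -> box p d (q + h) ->
  exists t : R, 0 <= t <= 1 /\
   f (q + h) - f q = h.1 * 'D_e1 f (q + t *: h) + h.2 * 'D_e2 f (q + t *: h).
Proof.
move=> df hq hqh.
have [t [t01 tE]] := mvt_is_derive ler01
  (fun t ht => is_derive_line (df _ (box_line ht hq hqh))).
exists t; split => //.
by move: tE; rewrite scale1r scale0r addr0 subr0 mulr1.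
Qed.

Lemma box_bounded f p : {for p, continuous f} ->
  exists2 d : R, 0 < d & forall x, box p d x -> `|f x| <= `|f p| + 1.
Proof.
move=> fc; have := fc; move=> /cvgrPdist_lt/(_ 1 ltr01)/nbhs_box[d d0 H].
exists d => // x /H /=; rewrite distrC => hx.
have := ler_normD (f x - f p) (f p); rewrite subrK; lra.
Qed.

Lemma box_sub p (d d' : R) x : d <= d' -> box p d x -> box p d' x.
Proof. by move=> dd [h1 h2]; split; exact: lt_le_trans dd. Qed.

(** Near [p] the second derivatives are bounded, so one use of the mean value
    theorem bounds the variation of the gradient, and another that of [f]. *)
Lemma taylor_lower f p (V : set (R * R)) :
  nbhs p V -> (forall vs x, V x -> differentiable (foldr (fun v g => 'D_v g) f vs) x) ->
  exists2 d : R, 0 < d & exists2 M : R, 0 < M & box p d `<=` V /\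
   forall q h, box p d q -> box p d (q + h) ->
    f q + (h.1 * 'D_e1 f q + h.2 * 'D_e2 f q) - M * (`|h.1| + `|h.2|) ^+ 2 <= f (q + h).
Proof.
move=> pV dfV.
have bnd vs : exists2 d : R, 0 < d & forall x, box p d x ->
    `|foldr (fun v g => 'D_v g) f vs x| <= `|foldr (fun v g => 'D_v g) f vs p| + 1.
  apply: box_bounded; apply: differentiable_continuous; apply: dfV.
  exact: nbhs_singleton pV.
pose M := (`|'D_e1 ('D_e1 f) p| + 1) + (`|'D_e2 ('D_e1 f) p| + 1) +
          (`|'D_e1 ('D_e2 f) p| + 1) + (`|'D_e2 ('D_e2 f) p| + 1).
have sum4 (a b c d : R) : 0 <= a -> 0 <= b -> 0 <= c -> 0 <= d ->
    let s := a + 1 + (b + 1) + (c + 1) + (d + 1) in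
    [/\ a + 1 <= s, b + 1 <= s, c + 1 <= s, d + 1 <= s & 0 < s].
  by move=> ? ? ? ? /=; split; lra.
have [m1 m2 m3 m4 M0] : [/\ _, _, _, _ & _] := sum4 _ _ _ _
  (normr_ge0 ('D_e1 ('D_e1 f) p)) (normr_ge0 ('D_e2 ('D_e1 f) p))
  (normr_ge0 ('D_e1 ('D_e2 f) p)) (normr_ge0 ('D_e2 ('D_e2 f) p)).
rewrite -/M in m1 m2 m3 m4 M0.
have [d d0 dP] : exists2 d : R, 0 < d & forall x, box p d x ->
   V x /\ [/\ `|'D_e1 ('D_e1 f) x| <= M, `|'D_e2 ('D_e1 f) x| <= M,
              `|'D_e1 ('D_e2 f) x| <= M & `|'D_e2 ('D_e2 f) x| <= M].
  have [d0 d00 b0] := nbhs_box pV.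
  have [d1 d10 b1] := bnd [:: e1; e1]; have [d2 d20 b2] := bnd [:: e2; e1].
  have [d3 d30 b3] := bnd [:: e1; e2]; have [d4 d40 b4] := bnd [:: e2; e2].
  exists (Num.min d0 (Num.min (Num.min d1 d2) (Num.min d3 d4))).
    by rewrite !lt_min d00 d10 d20 d30 d40.
  move=> x hx.
  split; first by apply: b0; apply: box_sub hx; rewrite ge_min lexx.
  split.
  - apply: le_trans m1; apply: b1; apply: box_sub hx; by rewrite !ge_min lexx !orbT.
  - apply: le_trans m2; apply: b2; apply: box_sub hx; by rewrite !ge_min lexx !orbT.
  - apply: le_trans m3; apply: b3; apply: box_sub hx; by rewrite !ge_min lexx !orbT.
  - apply: le_trans m4; apply: b4; apply: box_sub hx; by rewrite !ge_min lexx !orbT.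
exists d => //; exists M => //; split; first by move=> x /dP[].
move=> q h hq hqh.
have dV x : box p d x -> V x by move=> /dP[].
have [t [t01 tE]] := mvt_box (fun x hx => dfV [::] x (dV x hx)) hq hqh.
have ht := box_line t01 hq hqh.
set L := `|h.1| + `|h.2|.
have L0 : 0 <= L by rewrite addr_ge0.
have part (g : R * R -> R) : (forall x, box p d x -> differentiable g x) ->
   (forall x, box p d x -> `|'D_e1 g x| <= M /\ `|'D_e2 g x| <= M) ->
   `|g (q + t *: h) - g q| <= M * L.
  move=> dg bg; have [s [s01 ->]] := mvt_box dg hq ht.
  have [b1 b2] := bg _ (box_line s01 hq ht).
  have /andP[t0 t1] := t01.
  rewrite /GRing.scale/=; apply: (le_trans (ler_normD _ _)).
  rewrite !normrM (ger0_norm t0) /L mulrDr.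
  have n1 := normr_ge0 h.1; have n2 := normr_ge0 h.2.
  have th (y : R) : 0 <= y -> t * y <= y by move=> y0; rewrite ler_piMl.
  apply: lerD; rewrite [leRHS]mulrC; apply: ler_pM; rewrite ?mulr_ge0 ?th//.
have p1 := part ('D_e1 f) (fun x hx => dfV [:: e1] x (dV x hx)).
have p2 := part ('D_e2 f) (fun x hx => dfV [:: e2] x (dV x hx)).
have {}p1 : `|'D_e1 f (q + t *: h) - 'D_e1 f q| <= M * L.
  by apply: p1 => x /dP[_ [b1 b2 _ _]]; exact: (conj b1 b2).
have {}p2 : `|'D_e2 f (q + t *: h) - 'D_e2 f q| <= M * L.
  by apply: p2 => x /dP[_ [_ _ b3 b4]]; exact: (conj b3 b4).
set x := q + t *: h in tE p1 p2 *.
have : `|h.1 * ('D_e1 f x - 'D_e1 f q) + h.2 * ('D_e2 f x - 'D_e2 f q)| <= M * L ^+ 2.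
  have -> : M * L ^+ 2 = `|h.1| * (M * L) + `|h.2| * (M * L) by rewrite /L; ring.
  by apply: (le_trans (ler_normD _ _)); rewrite !normrM; apply: lerD; apply: ler_wpM2l.
rewrite ler_norml => /andP[lo _].
have -> : f (q + h) = f q + (h.1 * 'D_e1 f x + h.2 * 'D_e2 f x) by rewrite -tE addrCA subrr addr0.
move: lo; move: ('D_e1 f x) ('D_e2 f x) ('D_e1 f q) ('D_e2 f q) => a b a' b'.
move: (M * L ^+ 2) (f q) (h.1) (h.2) => m fq u v lo; rewrite -subr_ge0.
have -> : fq + (u * a + v * b) - (fq + (u * a' + v * b') - m) =
  u * (a - a') + v * (b - b') - - m by ring.
by rewrite subr_ge0.
Qed.
End Taylor.

Section Exterior.
Variable R : realType.
Implicit Types (D : set (Cplane R)) (z w p q : Cplane R).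

(** A point [h] of the disc of radius [r] tangent at the origin, with unit
    normal [n], satisfies [|h| ^ 2 <= 2 r (h . n)]; for small [r] the linear term
    [G (h . n)] therefore dominates the quadratic one. *)
Lemma tangent_disc_ineq (h1 h2 n1 n2 r G m M : R) :
  0 < r -> n1 ^+ 2 + n2 ^+ 2 = 1 -> 0 < m -> m <= G -> 0 < M -> r <= m / (4 * M) ->
  (h1 - r * n1) ^+ 2 + (h2 - r * n2) ^+ 2 <= r ^+ 2 ->
  M * (`|h1| + `|h2|) ^+ 2 <= h1 * (G * n1) + h2 * (G * n2).
Proof.
move=> r0 n12 m0 mG M0 rM hr.
set s := h1 ^+ 2 + h2 ^+ 2; set t := h1 * n1 + h2 * n2.
have s0 : 0 <= s by rewrite addr_ge0 ?sqr_ge0.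
have st : s <= 2 * r * t.
  have E : (h1 - r * n1) ^+ 2 + (h2 - r * n2) ^+ 2 = s - 2 * r * t + r ^+ 2 * (n1 ^+ 2 + n2 ^+ 2).
    by rewrite /s /t; ring.
  by move: hr; rewrite E n12 mulr1 gerDr subr_le0.
have t0 : 0 <= t by have := le_trans s0 st; rewrite pmulr_rge0// mulr_gt0.
have abs : (`|h1| + `|h2|) ^+ 2 <= 2 * s.
  rewrite /s -[h1 ^+ 2]real_normK ?num_real// -[h2 ^+ 2]real_normK ?num_real//.
  by have := sqr_ge0 (`|h1| - `|h2|); move: (`|h1|) (`|h2|) => a b; clear; nra.
have -> : h1 * (G * n1) + h2 * (G * n2) = G * t by rewrite /t; ring.
have h3 : M * (`|h1| + `|h2|) ^+ 2 <= M * (2 * s) by rewrite ler_pM2l.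
have h4 : M * (2 * s) <= M * (2 * (2 * r * t)) by rewrite ler_pM2l// ler_pM2l.
have h5 : M * (2 * (2 * r * t)) <= m * t.
  have -> : M * (2 * (2 * r * t)) = (r * (4 * M)) * t by ring.
  by apply: ler_wpM2r => //; rewrite -ler_pdivlMr// mulr_gt0.
apply: (le_trans h3); apply: (le_trans h4); apply: (le_trans h5).
exact: ler_wpM2r.
Qed.

Lemma to_R2_box p w (d : R) : modulus (w - p) < d -> box (to_R2 p) d (to_R2 w).
Proof.
move=> h; split; apply: le_lt_trans h.
  by have := Re_le_modulus (w - p); case: (w) (p) => ? ? [? ?].
by have := Im_le_modulus (w - p); case: (w) (p) => ? ? [? ?].
Qed.

Lemma to_R2_inj : injective (@to_R2 R).
Proof. by move=> [a b] [c d] /= [-> ->]. Qed.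

Lemma nbhs_to_R2 p (U : set (Cplane R)) : nbhs p U -> nbhs (to_R2 p) (@to_R2 R @` U).
Proof.
move=> /nbhs_modulus[d d0 dU].
have d2 : 0 < d / 2 by rewrite divr_gt0.
apply: filterS (box_nbhs (to_R2 p) d2) => -[a b] [/= h1 h2].
exists (Complex a b) => //; apply: dU.
apply: (le_lt_trans (modulus_le _)); move: h1 h2; case: (p) => c e /= h1 h2; lra.
Qed.

(** At a point [p'] outside [D] the defining function is nonnegative, and by
    [taylor_lower] it stays so on a small disc tangent at [p'] on the side of its
    gradient. Allowing all such [p'], not only boundary points, spares the choice
    of a nearest boundary point later. *)
Lemma exterior_disc D p : smooth_boundary D -> boundary D p ->
  exists2 e : R, 0 < e & exists2 r : R, 0 < r &
  forall p', modulus (p' - p) < e -> ~ D p' ->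
  exists q, modulus (p' - q) = r /\ forall w, D w -> r < modulus (w - q).
Proof.
move=> sD /sD[U [rho [oU Up rhoU drho DU]]].
have pU : nbhs p U by exact: open_nbhs_nbhs.
have [d d0 [M M0 [dV tay]]] := taylor_lower (nbhs_to_R2 pU) rhoU.
set e1 : R * R := (1, 0) in tay; set e2 : R * R := (0, 1) in tay.
pose gr x := 'D_e1 rho x ^+ 2 + 'D_e2 rho x ^+ 2.
have Vp : (@to_R2 R @` U) (to_R2 p) by exists p.
have grc : {for to_R2 p, continuous gr}.
  have c1 : {for to_R2 p, continuous ('D_e1 rho)}.
    by apply: differentiable_continuous; exact: (rhoU [:: e1] _ Vp).
  have c2 : {for to_R2 p, continuous ('D_e2 rho)}.
    by apply: differentiable_continuous; exact: (rhoU [:: e2] _ Vp).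
  by apply: cvgD; [exact: (cvgM c1 c1)|exact: (cvgM c2 c2)].
have gr0 : 0 < gr (to_R2 p).
  rewrite lt_neqAle addr_ge0 ?sqr_ge0// andbT eq_sym; apply/negP => /eqP.
  move/eqP; rewrite paddr_eq0 ?sqr_ge0// !sqrf_eq0 => /andP[/eqP g1 /eqP g2].
  have [v] := drho p Up; have dr := rhoU [::] _ Vp.
  rewrite -(deriveE v dr).
  by rewrite (derive_partials v dr) -/e1 -/e2 g1 g2 !mulr0 addr0 eqxx.
have [d2 d20 gd2] : exists2 d2 : R, 0 < d2 &
    forall x, box (to_R2 p) d2 x -> gr (to_R2 p) / 2 < gr x.
  have g2 : 0 < gr (to_R2 p) / 2 by rewrite divr_gt0.
  have /cvgrPdist_lt/(_ _ g2)/nbhs_box[d2 d20 H] := grc.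
  exists d2 => // x /H /=; rewrite ltr_norml => /andP[_ h].
  by move: (gr x) (gr (to_R2 p)) h => a b; lra.
pose m := Num.sqrt (gr (to_R2 p) / 2).
have m0 : 0 < m by rewrite sqrtr_gt0 divr_gt0.
(* The first bound makes the gradient dominate the second-order error, the
   second keeps the disc in the box. *)
pose r := Num.min (m / (4 * M)) (d / 8).
have r0 : 0 < r by rewrite lt_min !divr_gt0// mulr_gt0.
have rm : r <= m / (4 * M) by rewrite /r ge_min lexx.
have rd : r <= d / 8 by rewrite /r ge_min lexx orbT.
exists (Num.min (d / 2) d2); first by rewrite lt_min d20 divr_gt0.
exists r => // p'; rewrite lt_min => /andP[p'd p'd2] nDp'.
have hd2 : d / 2 <= d by rewrite ler_pdivrMr// ler_peMr// ?ltW// ltr1n.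
have bp' : box (to_R2 p) d (to_R2 p').
  exact: box_sub (to_R2_box p'd).
have rho_neg w : box (to_R2 p) d (to_R2 w) -> 0 <= rho (to_R2 w) -> ~ D w.
  move=> /dV[w' Uw' /to_R2_inj ww'] rho0 Dw; subst w'.
  have : (D `&` U) w by [].
  by rewrite DU => -[/=]; rewrite ltNge rho0.
have rho_p' : 0 <= rho (to_R2 p').
  have [w' Uw' /to_R2_inj ww'] := dV _ bp'; subst w'.
  rewrite leNgt; apply/negP => h; apply: nDp'.
  have : ([set z | rho (to_R2 z) < 0] `&` U) p' by [].
  by rewrite -DU => -[].
pose G := Num.sqrt (gr (to_R2 p')).
have grp' := gd2 _ (to_R2_box p'd2).
have mG : m <= G by apply: ler_wsqrtr; exact: ltW.
have G0 : 0 < G by exact: lt_le_trans mG.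
have GG : G ^+ 2 = gr (to_R2 p') by rewrite sqr_sqrtr// addr_ge0 ?sqr_ge0.
pose n1 := 'D_e1 rho (to_R2 p') / G; pose n2 := 'D_e2 rho (to_R2 p') / G.
have n12 : n1 ^+ 2 + n2 ^+ 2 = 1.
  by rewrite /n1 /n2 !exprMn -mulrDl -/(gr _) -GG -exprMn divff ?gt_eqF// expr1n.
have g1E : 'D_e1 rho (to_R2 p') = G * n1 by rewrite /n1 mulrCA divff ?mulr1// gt_eqF.
have g2E : 'D_e2 rho (to_R2 p') = G * n2 by rewrite /n2 mulrCA divff ?mulr1// gt_eqF.
clearbody n1 n2.
pose v : Cplane R := Complex (r * n1) (r * n2).
have vr : modulus v = r.
  rewrite modulusE /= !exprMn -mulrDr n12 mulr1 sqrtr_sqr gtr0_norm//.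
exists (p' + v); split; first by rewrite opprD addrA subrr sub0r modulusN.
move=> w Dw; rewrite ltNge; apply/negP => wr.
have wp' : modulus (w - p') < d / 2.
  have := modulusD (w - (p' + v)) v; rewrite vr {1}opprD addrA subrK => h.
  apply: (le_lt_trans h); apply: (@le_lt_trans _ _ (r + r)); first by rewrite lerD2r.
  by move: r0 rd; clearbody r; clear; lra.
have wp : modulus (w - p) < d.
  have := modulusD (w - p') (p' - p); rewrite addrA subrK => h.
  by apply: (le_lt_trans h); rewrite [d]splitr ltrD.
apply: (rho_neg w) Dw; first exact: to_R2_box.
pose h : R * R := to_R2 (w - p').
have wh : to_R2 w = to_R2 p' + h.
  by apply: injective_projections; rewrite /h /=; case: (w) (p') => ? ? [? ?] /=; ring.
have := tay (to_R2 p') h bp'; rewrite -wh => /(_ (to_R2_box wp)).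
apply: le_trans.
rewrite g1E g2E.
rewrite -addrA addr_ge0// subr_ge0.
apply: (@tangent_disc_ineq _ _ _ _ r G m) => //.
have : modulus (w - (p' + v)) ^+ 2 <= r ^+ 2 by rewrite lerXn2r ?nnegrE ?modulus_ge0// ltW.
rewrite sqr_modulus /h /v; case: (w) (p') => a b [a' b'] /=.
by congr (_ <= _); ring.
Qed.
End Exterior.

(** * Comparison of the density with the distance to the boundary *)

Section Lower.
Variable R : realType.
Implicit Types (D : set (Cplane R)) (z w p q : Cplane R).

(** That is, [c_D(z) >= c / dist(z, complement of D)]. *)
Definition distance_bound D (c : R) z : Prop :=
  D z -> forall p, ~ D p -> ((c / modulus (z - p))%:E <= caratheodory D z)%E.

Lemma distance_bound_le D (c c' : R) z : c' <= c ->
  distance_bound D c z -> distance_bound D c' z.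
Proof.
move=> cc H Dz p Dp; apply: le_trans (H Dz p Dp).
by rewrite lee_fin ler_wpM2r// invr_ge0 modulus_ge0.
Qed.

Lemma dist_notin_gt0 D z p : D z -> ~ D p -> 0 < modulus (z - p).
Proof. by move=> Dz Dp; rewrite modulus_gt0 subr_eq0; apply/eqP => zp; rewrite -zp in Dp. Qed.

Lemma bounded_modulus D : bounded_set D ->
  exists2 M : R, 0 < M & forall w, D w -> modulus w <= M.
Proof.
move=> [M0 [M0r H]]; exists (`|complex.Re M0| + 1); first by rewrite ltr_pwDr.
move=> w Dw; have := H (`|complex.Re M0| + 1)%:C%C.
rewrite -(RRe_real M0r) ltcR => /(_ _ w Dw); rewrite /= normE lecR; apply.
by have := ler_norm (complex.Re M0); lra.
Qed.

Lemma near_boundary_bound D p : smooth_boundary D -> boundary D p ->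
  exists2 e : R, 0 < e & exists2 c : R, 0 < c &
  forall z p', modulus (z - p) < e -> modulus (p' - p) < e -> D z -> ~ D p' ->
    ((c / modulus (z - p'))%:E <= caratheodory D z)%E.
Proof.
move=> sD bp; have [e e0 [r r0 H]] := exterior_disc sD bp.
exists e => //; exists (r / (2 * e + 2 * r)).
  by rewrite divr_gt0// addr_gt0 ?mulr_gt0.
move=> z p' ze p'e Dz Dp'.
have [q [p'q Dq]] := H p' p'e Dp'.
apply: le_trans (caratheodory_exterior_disc Dz r0 Dq); rewrite lee_fin.
have zq := Dq z Dz.
have d0 := dist_notin_gt0 Dz Dp'.
have zq' : modulus (z - q) <= modulus (z - p') + r.
  by rewrite -p'q; apply: le_trans (modulusD _ _); rewrite addrA subrK.
have zp' : modulus (z - p') <= 2 * e.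
  have := modulusD (z - p) (p - p'); rewrite addrA subrK (modulusB p p') => h.
  by apply: (le_trans h); rewrite mulr2n mulrDl mul1r ltW// ltrD.
move: (modulus (z - q)) (modulus (z - p')) zq d0 zq' zp' => b a zq d0 zq' zp'.
have bE : b ^+ 2 - r ^+ 2 = (b - r) * (b + r) by ring.
have b0 : 0 < b - r by rewrite subr_gt0.
have h1 : 0 < b ^+ 2 - r ^+ 2 by rewrite bE mulr_gt0//; lra.
have h2 : 0 < (2 * e + 2 * r) * a by rewrite mulr_gt0// addr_gt0 ?mulr_gt0.
rewrite -mulrA ler_pM2l// -invfM lef_pV2 ?posrE//.
rewrite bE [leRHS]mulrC; apply: ler_pM; lra.
Qed.

(** Near an interior or exterior point of [D] no pair [z], [p] has both points
    close to [x], and near a boundary point exterior discs apply. When [p] is not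
    close to [x], only the boundedness of [D] matters. *)
Lemma local_distance_bound D x : bounded_set D -> smooth_boundary D ->
  exists2 e : R, 0 < e & exists2 c : R, 0 < c &
  forall z, modulus (z - x) < e -> distance_bound D c z.
Proof.
move=> bD sD.
have [e e0 [c c0 H]] : exists2 e : R, 0 < e & exists2 c : R, 0 < c &
  forall z p, modulus (z - x) < e -> modulus (p - x) < e -> D z -> ~ D p ->
    ((c / modulus (z - p))%:E <= caratheodory D z)%E.
  have [cx|ncx] := pselect (closure D x); last first.
    have : nbhs x (~` D).
      have : nbhs x (~` closure D).
        by apply: open_nbhs_nbhs; split => //; apply: closed_openC; exact: closed_closure.
      by apply: filterS => w nw Dw; apply: nw; exact: subset_closure.
    move=> /nbhs_modulus[e e0 H]; exists e => //; exists 1 => // z p ze _ Dz.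
    by have := H z ze.
  have [ix|nix] := pselect (interior D x).
    move: ix => /nbhs_modulus[e e0 H]; exists e => //; exists 1 => // z p _ pe _.
    by have := H p pe.
  exact: near_boundary_bound.
have [M M0 DM] := bounded_modulus bD.
have e2 : 0 < e / 2 by rewrite divr_gt0.
pose M2 := 2 * M + 1.
have M20 : 0 < M2 by rewrite /M2; lra.
exists (e / 2) => //; exists (Num.min c (e / 2 / M2)); first by rewrite lt_min c0 divr_gt0.
move=> z ze Dz p Dp.
have zp0 := dist_notin_gt0 Dz Dp.
have [zp|zp] := ltP (modulus (z - p)) (e / 2).
  have pe : modulus (p - x) < e.
    have := modulusD (p - z) (z - x); rewrite addrA subrK (modulusB p z) => h.
    by apply: (le_lt_trans h); rewrite [e]splitr ltrD.
  have ze' : modulus (z - x) < e by apply: (lt_trans ze); rewrite ltr_pdivrMr// ltr_pMr// ltr1n.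
  apply: le_trans (H z p ze' pe Dz Dp); rewrite lee_fin.
  by apply: ler_wpM2r; [rewrite invr_ge0 ltW|rewrite ge_min lexx].
(* The dilation (w - z) / M2 is the test function. *)
have DM2 w : D w -> modulus (w - z) < M2.
  move=> Dw; apply: (le_lt_trans (modulusD _ _)); rewrite modulusN.
  by have := DM _ Dw; have := DM _ Dz; rewrite /M2; lra.
apply: le_trans (caratheodory_bounded Dz M20 DM2).
rewrite lee_fin ler_pdivrMr// [leRHS]mulrC.
apply: (@le_trans _ _ (e / 2 / M2)); first by rewrite ge_min lexx orbT.
by rewrite ler_pM2r// invr_gt0.
Qed.

(** The local bounds remain true for smaller constants, so on a compact square
    containing [D] they hold together for all small [c]. *)
Lemma distance_bound_uniform D : bounded_set D -> smooth_boundary D ->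
  exists2 c : R, 0 < c & forall z, distance_bound D c z.
Proof.
move=> bD sD; have [M M0 DM] := bounded_modulus bD.
pose K : set (R * R) := `[- M, M] `*` `[- M, M].
have cK : compact K by apply: compact_setX; exact: segment_compact.
have /compact_near_coveringP cov := cK.
have HK : \forall c \near (0 : R)^'+, K `<=`
    [set x : R * R | distance_bound D c (Complex x.1 x.2)].
  apply: (cov R (0 : R)^'+ (fun c (x : R * R) => distance_bound D c (Complex x.1 x.2))).
  move=> x Kx.
  have [e e0 [c c0 H]] := local_distance_bound (Complex x.1 x.2) bD sD.
  have e2 : 0 < e / 2 by rewrite divr_gt0.
  exists (box x (e / 2), [set c' | c' < c]) => /=.
    by split; [exact: box_nbhs|exact: nbhs_right_lt].
  move=> [x' c'] /= [[h1 h2] cc].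
  apply: (@distance_bound_le _ c); first exact: ltW.
  apply: H; apply: (le_lt_trans (modulus_le _)) => /=; lra.
have [c [c0 Hc]] : exists c : R, 0 < c /\ K `<=`
    [set x : R * R | distance_bound D c (Complex x.1 x.2)].
  near (0 : R)^'+ => c; exists c; split; first by [].
  by near: c.
exists c => // z Dz.
have Kz : K (to_R2 z).
  have zM := DM _ Dz; split; rewrite /= in_itv/= -ler_norml.
    exact: le_trans (Re_le_modulus z) zM.
  exact: le_trans (Im_le_modulus z) zM.
by have := Hc _ Kz; case: (z) Dz => a b Dz /(_ Dz).
Unshelve. all: by end_near. Qed.

Lemma caratheodory_ge0 D z : (0 <= caratheodory D z)%E.
Proof.
apply: ereal_sup_ubound; exists (fun _ => 0).
  by split => // _ [w _ <-]; rewrite /unit_disc/= modulus0 ltr01.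
by have [_] := is_derive_cstC (0 : Cplane R) z; rewrite -derive1E => ->; rewrite modulus0.
Qed.

Lemma disc_sub_component D z (d : R) : 0 < d ->
  (forall w, modulus (w - z) < d -> D w) ->
  forall w, modulus (w - z) < d -> connected_component D z w.
Proof.
move=> d0 zD w wd.
pose g (t : R) : Cplane R :=
  Complex (complex.Re z + t * complex.Re (w - z)) (complex.Im z + t * complex.Im (w - z)).
have gE t : g t - z = t%:C%C * (w - z).
  by rewrite /g; case: (z) (w) => a b [a' b'] /=; apply/eqP; rewrite eq_complex/=;
    apply/andP; split; apply/eqP; ring.
have gc : continuous g.
  have lin (a b : R) : continuous (fun t : R => a + t * b).
    by move=> t; apply: cvgD; [exact: cvg_cst|apply: cvgM; [exact: cvg_id|exact: cvg_cst]].
  exact: continuous_Complex.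
exists (g @` `[0, 1]).
  split.
  - exists 0; first by rewrite /= in_itv/= lexx ler01.
    by apply/eqP; rewrite -subr_eq0 gE mul0r.
  - move=> _ [t /= + <-]; rewrite in_itv/= => /andP[t0 t1].
    apply: zD; rewrite gE modulusM modulus_real ger0_norm//.
    by apply: le_lt_trans wd; rewrite ler_piMl// modulus_ge0.
  - apply: connected_continuous_connected; first exact: segment_connected.
    exact: continuous_subspaceT.
exists 1; first by rewrite /= in_itv/= lexx ler01.
by apply/eqP; rewrite -(inj_eq (addIr (- z))) gE mul1r.
Qed.

(** The distance bound read backwards: a point [w] outside [D] satisfies
    [|w - z| >= c / c_D(z)]. The density is also finite and positive, which turns
    products of extended reals into products of reals. *)
Lemma caratheodory_disc D : smoothly_bounded_domain D ->
  exists2 c : R, 0 < c & forall z, D z -> exists k : R,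
    [/\ 0 < k, caratheodory D z = k%:E & forall w, modulus (w - z) < c / k -> D w].
Proof.
move=> [[_ oD _] bD sD].
have [c c0 H] := distance_bound_uniform bD sD.
exists c => // z Dz.
have [M M0 DM] := bounded_modulus bD.
have [p Dp] : exists p, ~ D p.
  exists (M + 1)%:C%C => /DM; rewrite modulus_real.
  by have := ler_norm (M + 1); lra.
have /nbhs_modulus[d d0 zD] : nbhs z D by exact: open_nbhs_nbhs.
have up := caratheodory_le d0 zD.
have low := H z Dz p Dp.
have fin : caratheodory D z \is a fin_num.
  rewrite fin_numE; apply/andP; split; apply/eqP => h.
    by move: low; rewrite h.
  by move: up; rewrite h.
exists (fine (caratheodory D z)); rewrite fineK//; split => //.
  rewrite -lte_fin fineK//; apply: lt_le_trans low.
  by rewrite lte_fin divr_gt0// (dist_notin_gt0 Dz).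
have k0 : 0 < fine (caratheodory D z).
  rewrite -lte_fin fineK//; apply: lt_le_trans low.
  by rewrite lte_fin divr_gt0// (dist_notin_gt0 Dz).
move=> w wz; apply: contrapT => Dw.
have := H z Dz w Dw; rewrite -(fineK fin) lee_fin.
have zw := dist_notin_gt0 Dz Dw.
by move: wz; rewrite modulusB ltr_pdivlMr// ler_pdivrMr// mulrC leNgt => ->.
Qed.

End Lower.

Theorem theorem2p1 (R : realType) (D1 D2 : set (Cplane R))
    (hD1 : smoothly_bounded_domain D1) (hD2 : smoothly_bounded_domain D2)
    (h12 : D1 `&` D2 !=set0) :
  exists C : R, 0 < C /\
    forall z : Cplane R, (D1 `&` D2) z ->
      (caratheodory (connected_component (D1 `&` D2) z) z
         * caratheodory (D1 `|` D2) z
       <= C%:E * (caratheodory D1 z * caratheodory D2 z))%E.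
Proof.
have [c1 c10 H1] := caratheodory_disc hD1.
have [c2 c20 H2] := caratheodory_disc hD2.
exists ((16 / c1) * (16 / c2)); split; first by rewrite mulr_gt0// divr_gt0.
move=> z [D1z D2z].
have [k1 [k10 -> d1]] := H1 z D1z; have [k2 [k20 -> d2]] := H2 z D2z.
have r10 : 0 < c1 / k1 by rewrite divr_gt0.
have r20 : 0 < c2 / k2 by rewrite divr_gt0.
have m0 : 0 < Num.min (c1 / k1) (c2 / k2) by rewrite lt_min r10.
have M0 : 0 < Num.max (c1 / k1) (c2 / k2) by rewrite lt_max r10.
have cap : (caratheodory (connected_component (D1 `&` D2) z) z
    <= (16 / Num.min (c1 / k1) (c2 / k2))%:E)%E.
  apply: caratheodory_le => //; apply: disc_sub_component => // w.
  by rewrite lt_min => /andP[w1 w2]; split; [exact: d1|exact: d2].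
have cup : (caratheodory (D1 `|` D2) z
    <= (16 / Num.max (c1 / k1) (c2 / k2))%:E)%E.
  apply: caratheodory_le => // w.
  by rewrite lt_max => /orP[w1|w2]; [left; exact: d1|right; exact: d2].
apply: (le_trans (lee_pmul (caratheodory_ge0 _ _) (caratheodory_ge0 _ _) cap cup)).
have minmax : Num.min (c1 / k1) (c2 / k2) * Num.max (c1 / k1) (c2 / k2) =
    (c1 / k1) * (c2 / k2) by case: leP => // _; rewrite mulrC.
rewrite -!EFinM lee_fin mulrACA -invfM minmax le_eqVlt; apply/orP; left.
by apply/eqP; field; rewrite !gt_eqF.
Qed.
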